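(* Let $\mathcal H$ be a real Hilbert space, let $m\geq 1$ be an integer, let $z\in\mathcal H$, and let $(\omega_i)_{1\leq i\leq m}$ be reals in $]0,1]$ such that $\sum_{i=1}^m\omega_i=1$. For every $i\in\{1,\ldots,m\}$, let $\mathcal G_i$ be a real Hilbert space, let $r_i\in\mathcal G_i$, let $g_i\in\Gamma_0(\mathcal G_i)$, and let $L_i\colon\mathcal H\to\mathcal G_i$ be a nonzero bounded linear operator. Assume that $$z\in\operatorname{ran}\sum_{i=1}^m\omega_iL_i^*\circ(\partial g_i)\circ(L_i\cdot-r_i).$$ Consider the problem $$\underset{x\in\mathcal H}{\text{minimize}}\;\;\sum_{i=1}^m\omega_i\,g_i(L_ix-r_i)-\langle x\mid z\rangle,\qquad\text{(P)}$$ and the problem $$\text{minimize}\;\;\sum_{i=1}^m\omega_i\big(g_i^*(v_i)+\langle v_i\mid r_i\rangle\big)\;\;\text{over } v_1\in\mathcal G_1,\ldots,v_m\in\mathcal G_m\text{ subject to }\sum_{i=1}^m\omega_iL_i^*v_i=z.\qquad\text{(D)}$$ For every $i\in\{1,\ldots,m\}$, let $(a_{1,i,n})_{n\in\mathbb N}$ and $(c_{1,i,n})_{n\in\mathbb N}$ be absolutely summable sequences in $\mathcal H$, let $(a_{2,i,n})_{n\in\mathbb N}$, $(b_{i,n})_{n\in\mathbb N}$, and $(c_{2,i,n})_{n\in\mathbb N}$ be absolutely summable sequences in $\mathcal G_i$, let $x_{i,0}\in\mathcal H$, and let $v_{i,0}\in\mathcal G_i$. Furthermore, set $\beta=\max_{1\leq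 i\leq m}\|L_i\|$, let $\varepsilon\in\,]0,1/(\beta+1)[$, let $(\gamma_n)_{n\in\mathbb N}$ be a sequence in $[\varepsilon,(1-\varepsilon)/\beta]$, and set, for every $n\in\mathbb N$, $x_n=\sum_{i=1}^m\omega_ix_{i,n}$; then, for $i=1,\ldots,m$, $$\begin{array}{l} y_{1,i,n}=x_{i,n}-\gamma_n(L_i^*v_{i,n}+a_{1,i,n})\\ y_{2,i,n}=v_{i,n}+\gamma_n(L_ix_{i,n}+a_{2,i,n}); \end{array}$$ then $p_{1,n}=\sum_{i=1}^m\omega_iy_{1,i,n}+\gamma_nz$; then, for $i=1,\ldots,m$, $$\begin{array}{l} p_{2,i,n}=\operatorname{prox}_{\gamma_ng_i^*}(y_{2,i,n}-\gamma_nr_i)+b_{i,n}\\ q_{1,i,n}=p_{1,n}-\gamma_n(L_i^*p_{2,i,n}+c_{1,i,n})\\ q_{2,i,n}=p_{2,i,n}+\gamma_n(L_ip_{1,n}+c_{2,i,n})\\ x_{i,n+1}=x_{i,n}-y_{1,i,n}+q_{1,i,n}\\ v_{i,n+1}=v_{i,n}-y_{2,i,n}+q_{2,i,n}. \end{array}$$ Then the following hold for some solution $\overline{x}$ to (P) and some solution $(\overline{v}_i)_{1\leq i\leq m}$ to (D) such that, for every $i\in\{1,\ldots,m\}$, $\overline{v}_i\in\partial g_i(L_i\overline{x}-r_i)$. (i) $x_n\rightharpoonup\overline{x}$ and, for every $i\in\{1,\ldots,m\}$, $v_{i,n}\rightharpoonup\overline{v}_i$. (ii) Suppose that, for every $i\in\{1,\ldots,m\}$,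 $g_i^*$ is strongly convex at $\overline{v}_i$. Then, for every $i\in\{1,\ldots,m\}$, $v_{i,n}\to\overline{v}_i$.
   Context: $\rightharpoonup$ and $\to$ denote weak and strong convergence; a sequence $(a_n)$ is absolutely summable if $\sum_n\|a_n\|<+\infty$. $L_i^*$ is the adjoint of $L_i$. $\Gamma_0(\mathcal H)$ is the class of lower semicontinuous convex functions $f\colon\mathcal H\to\,]-\infty,+\infty]$ with $\operatorname{dom}f=\{x\mid f(x)<+\infty\}\neq\varnothing$. The conjugate of $f$ is $f^*\colon u\mapsto\sup_{x\in\mathcal H}(\langle x\mid u\rangle-f(x))$; the subdifferential is $\partial f(x)=\{u\in\mathcal H\mid(\forall y\in\mathcal H)\ \langle y-x\mid u\rangle+f(x)\leq f(y)\}$; $\operatorname{prox}_fx$ is the unique minimizer of $f+\|x-\cdot\|^2/2$. The range of a set-valued operator $M$ is $\operatorname{ran}M=\{u\mid(\exists x)\ u\in Mx\}$, and $\sum_{i=1}^m\omega_iL_i^*\circ(\partial g_i)\circ(L_i\cdot-r_i)$ is the operator $x\mapsto\sum_{i=1}^m\omega_iL_i^*(\partial g_i(L_ix-r_i))$ (Minkowski sum of sets). A function $\varphi\in\Gamma_0(\mathcal H)$ is strongly convex at $x\in\operatorname{dom}\varphi$ if there exists $\rho\in\,]0,+\infty[$ such that, for every $y\in\operatorname{dom}\varphi$ and every $\alpha\in\,]0,1[$, $\varphi(\alpha x+(1-\alpha)y)+\alpha(1-\alpha)\frac{\rho}{2}\|x-y\|^2\leq\alpha\varphi(x)+(1-\alpha)\varphi(y)$.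 *)

(* Defs.v *)
From HB Require Import structures.
From mathcomp Require Import all_boot all_order all_algebra.
From mathcomp Require Import all_classical all_reals all_analysis.

Set Implicit Arguments.
Unset Strict Implicit.
Unset Printing Implicit Defensive.

Import Order.TTheory GRing.Theory Num.Theory.
Import numFieldNormedType.Exports.

Local Open Scope classical_set_scope.
Local Open Scope ring_scope.

(* [{dot V for idfun}] is the library's type of positive definite symmetric
   bilinear forms on V. *)
HB.mixin Record NormedModule_hasInner (R : realType) V & NormedModule R V := {
  inner : {dot V for (@idfun R)};
  inner_norm : forall x : V, inner x x = `|x| ^+ 2
}.

#[short(type="hilbertType")]
HB.structure Definition Hilbert (R : realType) :=
  {V of CompleteNormedModule R V & NormedModule_hasInner R V}.

Section HilbertDefs.
Context {R : realType}.

Definition weak_cvg (V : hilbertType R) (u : nat -> V) (l : V) :=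
  forall y : V, (fun n => inner (u n) y) @ \oo --> (inner l y : R).

Definition abs_summable (V : normedModType R) (a : nat -> V) :=
  (\sum_(0 <= n <oo) (`|a n|)%:E < +oo)%E.

Definition opnorm (V W : normedModType R) (L : V -> W) : R :=
  sup [set `|L x| | x in [set x : V | `|x| <= 1]].

(* The value is determined by the Riesz theorem when L is linear and bounded;
   0 is only a default. *)
Definition adjoint (V W : hilbertType R) (L : V -> W) (y : W) : V :=
  xget 0 [set u : V | forall x : V, inner (L x) y = inner x u].

Definition argmin (T : Type) (C : set T) (F : T -> \bar R) : set T :=
  [set x | C x /\ forall y, C y -> (F x <= F y)%E].

Definition dom (V : Type) (f : V -> \bar R) : set V :=
  [set x | (f x < +oo)%E].

(* Restricting to 0 < t < 1 avoids the product 0 * +oo. *)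
Definition convex_ereal (V : lmodType R) (f : V -> \bar R) :=
  forall (x y : V) (t : R), 0 < t < 1 ->
    (f (t *: x + (1 - t) *: y)%R <= t%:E * f x + (1 - t)%:E * f y)%E.

Definition Gamma0 (V : normedModType R) (f : V -> \bar R) :=
  [/\ lower_semicontinuous f, convex_ereal f,
      forall x, (-oo < f x)%E & dom f !=set0].

Definition conjugate (V : hilbertType R) (f : V -> \bar R) (u : V) : \bar R :=
  ereal_sup [set ((inner x u)%:E - f x)%E | x in [set: V]].

Definition subdifferential (V : hilbertType R) (f : V -> \bar R) (x : V)
    : set V :=
  [set u | forall y : V, ((inner (y - x)%R u)%:E + f x <= f y)%E].

(* For f in Gamma0 the set below is a singleton; 0 is only a default. *)
Definition prox (V : normedModType R) (f : V -> \bar R) (x : V) : V :=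
  xget 0 (argmin setT (fun y => (f y + (`|x - y| ^+ 2 / 2)%:E)%E)).

Definition strongly_convex_at (V : normedModType R) (f : V -> \bar R) (x : V) :=
  dom f x /\
  exists2 rho : R, 0 < rho & forall (y : V) (a : R), dom f y -> 0 < a < 1 ->
    (f (a *: x + (1 - a) *: y)%R + (a * (1 - a) * (rho / 2) * `|x - y| ^+ 2)%:E
       <= a%:E * f x + (1 - a)%:E * f y)%E.

Definition ran (T U : Type) (M : T -> set U) : set U :=
  [set u | exists x, M x u].

Definition minkowski_sum (m : nat) (V : zmodType) (A : 'I_m -> set V) : set V :=
  [set \sum_(i < m) a i | a in [set a : 'I_m -> V | forall i, A i (a i)]].

Section CompositeProblem.
Variables (H : hilbertType R) (m : nat) (z : H) (omega : 'I_m -> R).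
Variables (G : 'I_m -> hilbertType R) (r : forall i, G i).
Variables (g : forall i, G i -> \bar R) (L : forall i, {linear H -> G i}).
Arguments r : clear implicits.
Arguments g : clear implicits.
Arguments L : clear implicits.

Definition composite_operator (x : H) : set H :=
  minkowski_sum (fun i => [set omega i *: adjoint (L i) v
                          | v in subdifferential (g i) (L i x - r i)]).

Definition primal_objective (x : H) : \bar R :=
  (\sum_(i < m) (omega i)%:E * g i (L i x - r i)%R - (inner x z)%:E)%E.

Definition primal_solution : set H := argmin setT primal_objective.

Definition dual_objective (v : forall i, G i) : \bar R :=
  (\sum_(i < m)
     (omega i)%:E * (conjugate (g i) (v i) + (inner (v i) (r i))%:E))%E.

Definition dual_feasible : set (forall i, G i) :=
  [set v | \sum_(i < m) omega i *: adjoint (L i) (v i) = z].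

Definition dual_solution : set (forall i, G i) :=
  argmin dual_feasible dual_objective.

End CompositeProblem.
End HilbertDefs.

(* Main.v *)
Require Import Defs.
From mathcomp Require Import all_boot all_order all_algebra.
From mathcomp Require Import all_classical all_reals all_analysis.
From mathcomp Require Import ring lra.

Set Implicit Arguments.
Unset Strict Implicit.
Unset Printing Implicit Defensive.

Import Order.TTheory GRing.Theory Num.Theory.
Import numFieldNormedType.Exports.

Local Open Scope classical_set_scope.
Local Open Scope ring_scope.

(** The algorithm is Tseng's forward-backward-forward splitting method, with
    summable errors, in the product space of the families [(x_i, v_i)] under the
    weighted norm [sum_i omega_i (|x_i|^2 + |v_i|^2)]. A pair [(xb, vb)] with
    [vb_i] in [dg_i (L_i xb - r_i)] and [sum_i omega_i L_i^* vb_i = z] solves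
    both problems by the subgradient and Fenchel-Young inequalities
    ([kkt_primal], [kkt_dual]), and the range assumption provides one.

    From an iterate [(x_i, v_i)] the method computes a point [(p, ..., p, q)]
    by a forward step along the skew operator [S : (x, v) |-> (L^* v, - L x)]
    followed by a projection and proximity operators, and then corrects it by
    [gamma (S (x, v) - S (p, q))]. Monotonicity and skewness show that the exact
    step decreases the squared distance to every solution by at least
    [(1 - (gamma beta)^2)] times the squared distance from [(x, v)] to [(p, q)]
    ([fejer_step]). The errors perturb this by a summable relative amount
    ([sqdist_perturb]), so the distance of the iterates to each solution
    converges and their distance to [(p, q)] tends to 0 ([quasi_fejer],
    [inexact_fejer]).

    Consequently [(p, q)] satisfies the optimality system up to residuals that
    tend to 0 in norm ([step_perturbed_kkt]), and weak limit points are
    solutions ([perturbed_kkt_limit]): skewness makes the bilinear coupling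
    weakly continuous along the sequence, and Minty's argument, which tests
    with the proximity operator of [g_i], identifies the limit. Bounded sequences
    converge weakly along ultrafilters ([ultra_weak_lim]), and all these limits
    coincide by Opial's argument, whence weak convergence. If each [g_i^*] is
    strongly convex at [vb_i], the monotonicity gap, which tends to 0, dominates
    [|q_i - vb_i|^2], whence strong convergence ([perturbed_kkt_strong_limit]).

    Proximity operators, the Riesz theorem and hence adjoints all come from one
    minimization lemma for a convex function plus a squared distance
    ([argmin_prox_exists]). *)

(** * Inner product calculus *)

Section InnerProduct.
Context {R : realType} {V : hilbertType R}.
Implicit Types (x y z : V) (a : R).

Lemma innerC x y : inner x y = inner y x.
Proof. by rewrite hermC expr0 mul1r. Qed.

Lemma innerDl x y z : inner (x + y) z = inner x z + inner y z.
Proof. exact: linearDl. Qed.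

Lemma innerDr x y z : inner z (x + y) = inner z x + inner z y.
Proof. exact: linearDr. Qed.

Lemma innerNl x z : inner (- x) z = - inner x z.
Proof. exact: linearNl. Qed.

Lemma innerNr x z : inner z (- x) = - inner z x.
Proof. exact: linearNr. Qed.

Lemma innerBl x y z : inner (x - y) z = inner x z - inner y z.
Proof. exact: linearBl. Qed.

Lemma innerBr x y z : inner z (x - y) = inner z x - inner z y.
Proof. exact: linearBr. Qed.

Lemma innerZl a x z : inner (a *: x) z = a * inner x z.
Proof. by rewrite linearZl_LR. Qed.

Lemma innerZr a x z : inner z (a *: x) = a * inner z x.
Proof. by rewrite innerC innerZl innerC. Qed.

Lemma inner0l z : inner 0 z = 0.
Proof. exact: linear0l. Qed.

Lemma inner0r z : inner z 0 = 0.
Proof. exact: linear0r. Qed.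

Definition innerE := (innerDl, innerDr, innerNl, innerNr, innerZl, innerZr).

Lemma inner_suml (I : Type) (s : seq I) (P : pred I) (F : I -> V) z :
  inner (\sum_(i <- s | P i) F i) z = \sum_(i <- s | P i) inner (F i) z.
Proof. exact: linear_sumlz. Qed.

Lemma inner_sumr (I : Type) (s : seq I) (P : pred I) (F : I -> V) z :
  inner z (\sum_(i <- s | P i) F i) = \sum_(i <- s | P i) inner z (F i).
Proof. by rewrite innerC inner_suml; apply: eq_bigr => i _; rewrite innerC. Qed.

Lemma normD_sqr x y : `|x + y| ^+ 2 = `|x| ^+ 2 + 2 * inner x y + `|y| ^+ 2.
Proof. by rewrite -!inner_norm !innerE (innerC y x); ring. Qed.

Lemma normB_sqr x y : `|x - y| ^+ 2 = `|x| ^+ 2 - 2 * inner x y + `|y| ^+ 2.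
Proof. by rewrite -!inner_norm !innerE (innerC y x); ring. Qed.

Lemma three_point_identity x x' p b :
  `|x' - b| ^+ 2 = `|x - b| ^+ 2 - `|x - p| ^+ 2 + `|x' - p| ^+ 2
                   - 2 * inner (x - x') (p - b).
Proof.
rewrite -!inner_norm !innerE ?(innerC x' x) ?(innerC b x) ?(innerC b x').
by rewrite ?(innerC p x) ?(innerC p x') ?(innerC b p); ring.
Qed.

Lemma cauchy_schwarz x y : inner x y <= `|x| * `|y|.
Proof.
have [->|x0] := eqVneq x 0; first by rewrite inner0l normr0 mul0r.
have [->|y0] := eqVneq y 0; first by rewrite inner0r normr0 mulr0.
have xy0 : 0 < `|x| * `|y| by rewrite mulr_gt0 ?normr_gt0.
have := sqr_ge0 (`| `|y| *: x - `|x| *: y |).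
rewrite normB_sqr !normrZ !normr_id !innerE => h.
have : 0 <= `|x| * `|y| * (`|x| * `|y| - inner x y) by lra.
by rewrite pmulr_rge0// subr_ge0.
Qed.

Lemma normr_inner x y : `|inner x y| <= `|x| * `|y|.
Proof.
rewrite ler_norml cauchy_schwarz andbT lerNl -innerNl.
by rewrite (le_trans (cauchy_schwarz _ _))// normrN.
Qed.

Lemma inner_inj x y : (forall z, inner z x = inner z y) -> x = y.
Proof.
move=> h; apply/eqP; rewrite -subr_eq0 -normr_eq0 -sqrf_eq0 -inner_norm.
by rewrite innerBr h subrr.
Qed.

Lemma continuous_innerr x : continuous (fun y => inner x y : R).
Proof.
move=> y; apply/(@cvgrPdist_lt R R^o) => e e0.
near=> t; rewrite -innerBr.
apply: le_lt_trans (normr_inner _ _) _.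
have x1 : 0 < `|x| + 1 by rewrite ltr_wpDl.
apply: (@le_lt_trans _ _ ((`|x| + 1) * `|y - t|)).
  by rewrite ler_wpM2r// lerDl.
rewrite mulrC -ltr_pdivlMr//.
near: t; apply: (@cvgr_dist_lt R V V (nbhs y) _ id y) => //.
exact: divr_gt0.
Unshelve. all: by end_near. Qed.

End InnerProduct.

(** * Proximity operators *)

Section Prox.
Context {R : realType} {V : hilbertType R}.
Implicit Types (f : V -> \bar R) (x y p : V).

(** The lower bound that makes the prox problem coercive. Every function of
    class [Gamma0] satisfies it by the Hahn-Banach theorem; below it comes
    from a subgradient or from a bound on a linear functional. *)
Definition norm_minorized f :=
  exists c b : R, 0 <= b /\ forall y, ((c - b * `|y|)%:E <= f y)%E.

Lemma Gamma0_fineK f y : Gamma0 f -> dom f y -> (fine (f y))%:E = f y.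
Proof.
move=> [_ _ fNy _] fy; rewrite fineK// fin_numE gt_eqF ?fNy//=.
by rewrite lt_eqF.
Qed.

Lemma convex_fine f x y (t : R) : Gamma0 f -> dom f x -> dom f y -> 0 < t < 1 ->
  dom f (t *: x + (1 - t) *: y) /\
  fine (f (t *: x + (1 - t) *: y)) <= t * fine (f x) + (1 - t) * fine (f y).
Proof.
move=> f0 fx fy t01; have [_ cf _ _] := f0; have := cf x y t t01.
rewrite -{1}(Gamma0_fineK f0 fx) -{1}(Gamma0_fineK f0 fy) -!EFinM -EFinD => h.
have fz : dom f (t *: x + (1 - t) *: y) by apply: le_lt_trans h _; rewrite ltry.
by split=> //; rewrite -lee_fin (Gamma0_fineK f0 fz).
Qed.

Definition prox_cost f x y : R := fine (f y) + `|x - y| ^+ 2 / 2.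

(** The parallelogram identity turns convexity of [f] into strong convexity of
    the prox cost. *)
Lemma prox_cost_midpoint f x y y' : Gamma0 f -> dom f y -> dom f y' ->
  exists2 w, dom f w &
    prox_cost f x w + `|y - y'| ^+ 2 / 8
      <= (prox_cost f x y + prox_cost f x y') / 2.
Proof.
move=> f0 fy fy'.
have h12 : 0 < (2^-1 : R) < 1 by apply/andP; split; lra.
have [fw hw] := convex_fine f0 fy fy' h12.
exists (2^-1 *: y + (1 - 2^-1) *: y') => //; rewrite /prox_cost.
have -> : x - (2^-1 *: y + (1 - 2^-1) *: y')
   = 2^-1 *: ((x - y) + (x - y')).
  have -> : 1 - 2^-1 = 2^-1 :> R by field.
  rewrite -scalerDr.
  have {1}-> : x = 2^-1 *: (x + x).
    by rewrite -[x in x + x]scale1r -scalerDl scalerA mulVf ?scale1r.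
  by rewrite -scalerBr addrACA opprD.
have -> : y - y' = (x - y') - (x - y).
  by rewrite opprB [RHS]addrC [RHS]addrA subrK.
rewrite normrZ exprMn (normD_sqr (x - y)) (normB_sqr (x - y')).
rewrite (innerC (x - y')).
rewrite [in X in X ^+ 2 * _]ger0_norm; last lra.
by nra.
Qed.

Lemma prox_cost_lower_bound f x y (c b : R) : Gamma0 f ->
  ((c - b * `|y|)%:E <= f y)%E -> 0 <= b -> dom f y ->
  c - b * `|x| - b ^+ 2 / 2 <= prox_cost f x y.
Proof.
move=> f0 + b0 fy; rewrite -(Gamma0_fineK f0 fy) lee_fin => hy.
rewrite /prox_cost.
have : `|y| <= `|x| + `|x - y|.
  by rewrite -{1}(subKr x y) (le_trans (ler_normB _ _)).
move=> /(ler_wpM2l b0); have := sqr_ge0 (`|x - y| - b).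
rewrite sqrrB => *; lra.
Qed.

(** A minimizing sequence is Cauchy by the parallelogram identity, and lower
    semicontinuity carries the infimum to its limit. *)
Lemma argmin_prox_exists f x : Gamma0 f -> norm_minorized f ->
  argmin setT (fun y => (f y + (`|x - y| ^+ 2 / 2)%:E)%E) !=set0.
Proof.
move=> f0 [c [b [b0 fcb]]].
have [lsf _ fNy [y0 fy0]] := f0.
pose A := [set prox_cost f x y | y in dom f].
have lbA : has_lbound A.
  exists (c - b * `|x| - b ^+ 2 / 2) => _ [y fy <-].
  exact: prox_cost_lower_bound.
have infA : has_inf A by split=> //; exists (prox_cost f x y0); exists y0.
pose mu := inf A.
have mu_le y : dom f y -> mu <= prox_cost f x y.
  by move=> fy; apply: ge_inf => //; exists y.
have /choice[u hu] : forall n : nat, exists y,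
    dom f y /\ prox_cost f x y < mu + n.+1%:R^-1.
  move=> n; have n0 : 0 < (n.+1%:R^-1 : R) by rewrite invr_gt0.
  by have [_ [y fy <-] hy] := inf_adherent n0 infA; exists y.
have u_close n k : `|u n - u k| ^+ 2 <= 4 * (n.+1%:R^-1 + k.+1%:R^-1).
  have [fn hn] := hu n; have [fk hk] := hu k.
  have [w fw] := prox_cost_midpoint x f0 fn fk; have := mu_le _ fw.
  move: hn hk; move: (n.+1%:R^-1) (k.+1%:R^-1) (mu) (prox_cost f x).
  move=> a a' mu' F *.
  by lra.
have u_cvg : cvg (u @ \oo).
  apply: cauchy_cvg; apply: cauchy_exP => e e0.
  have [N _ hN] : \forall n \near \oo, n.+1%:R^-1 < e ^+ 2 / 8.
    apply: (near_infty_natSinv_lt (PosNum _)).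
    by rewrite divr_gt0// exprn_gt0.
  exists (u N); exists N => // n /= Nn.
  rewrite -ball_normE /ball_ /= -(@ltr_pXn2r _ 2)// ?nnegrE ?(ltW e0)//.
  apply: le_lt_trans (u_close _ _) _.
  have := hN N (leqnn N); have := hN n Nn; rewrite /=.
  by move: (n.+1%:R^-1) (N.+1%:R^-1) => s s' *; lra.
set p := lim (u @ \oo).
have up : u @ \oo --> p by exact: u_cvg.
have fp_lt a : (a%:E < f p)%E -> a <= mu - `|x - p| ^+ 2 / 2.
  move=> /lsf[W Wp Wf].
  have l1 : (fun n : nat => mu + n.+1%:R^-1 - `|x - u n| ^+ 2 / 2) @ \oo -->
      (mu - `|x - p| ^+ 2 / 2 : R).
    apply: cvgB; last first.
      apply: cvgM; last exact: cvg_cst.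
      apply: (@continuous_cvg _ _ _ _ _ (fun n => `|x - u n|)
                (fun t : R => t ^+ 2)).
        exact: exprn_continuous.
      by apply: cvg_norm; apply: cvgB => //; exact: cvg_cst.
    rewrite -[X in _ --> X]addr0; apply: cvgD; first exact: cvg_cst.
    exact: cvg_harmonic.
  rewrite -(cvg_lim (@Rhausdorff R) l1); apply: limr_ge.
    by apply/cvg_ex; eexists; exact: l1.
  have uW : \forall n \near \oo, W (u n) := up _ Wp.
  apply: filterS uW => n Wu.
  have [fn hn] := hu n; have := Wf _ Wu.
  rewrite -(Gamma0_fineK f0 fn) lte_fin; rewrite /prox_cost in hn => *.
  by move: hn; move: (n.+1%:R^-1) (mu) => s mu' *; lra.
have fp : (f p <= (mu - `|x - p| ^+ 2 / 2)%:E)%E.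
  case E : (f p) => [s| |]; last by rewrite leNye.
    rewrite lee_fin leNgt; apply/negP => h.
    have := fp_lt ((s + (mu - `|x - p| ^+ 2 / 2)) / 2).
    by rewrite E lte_fin; clear E => h'; lra.
  have := fp_lt (mu - `|x - p| ^+ 2 / 2 + 1).
  by rewrite E ltry => /(_ isT); rewrite gerDl ler10.
exists p; split=> // y _.
have [fy|] := pselect (dom f y); last first.
  rewrite /dom/= => /negP; rewrite -leNgt leye_eq => /eqP ->.
  by rewrite addye// leey.
have fp' : dom f p by apply: le_lt_trans fp _; rewrite ltry.
rewrite -(Gamma0_fineK f0 fy) -(Gamma0_fineK f0 fp') -!EFinD lee_fin.
apply: le_trans (mu_le _ fy).
by move: fp; rewrite -(Gamma0_fineK f0 fp') lee_fin => *; lra.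
Qed.

(** Comparing the minimizer [p] with [p + t (y - p)] and letting [t] tend to 0
    gives the first-order condition. *)
Lemma argmin_prox_subdifferential f x p : Gamma0 f ->
  argmin setT (fun y => (f y + (`|x - y| ^+ 2 / 2)%:E)%E) p ->
  subdifferential f p (x - p).
Proof.
move=> f0 [_ pmin]; have [_ _ fNy [y0 fy0]] := f0.
have fp : dom f p.
  have := pmin y0 Logic.I; rewrite -(Gamma0_fineK f0 fy0) -EFinD.
  case E : (f p) => [s| |]; rewrite /dom/= E ?ltry//.
move=> y; have [fy|] := pselect (dom f y); last first.
  rewrite /dom/= => /negP; rewrite -leNgt leye_eq => /eqP ->.
  by rewrite leey.
rewrite -(Gamma0_fineK f0 fy) -(Gamma0_fineK f0 fp) -!EFinD lee_fin.
set d := inner _ _; set fy' := fine (f y); set fp' := fine (f p).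
have key t : 0 < t < 1 -> d + fp' <= fy' + t * (`|y - p| ^+ 2 / 2).
  move=> t01; have [fw hw] := convex_fine f0 fy fp t01.
  have := pmin (t *: y + (1 - t) *: p) Logic.I.
  rewrite -(Gamma0_fineK f0 fw) -(Gamma0_fineK f0 fp) -!EFinD lee_fin.
  have -> : x - (t *: y + (1 - t) *: p) = (x - p) - t *: (y - p).
    by rewrite scalerBl scale1r scalerBr addrCA opprD addrA.
  rewrite [in leRHS]normB_sqr innerZr innerC -/d normrZ exprMn.
  rewrite real_normK ?num_real//.
  move: t01 => /andP[t0 t1] h.
  have : t * (d + fp') <= t * (fy' + t * (`|y - p| ^+ 2 / 2)).
    rewrite -/fy' -/fp' in h hw; nra.
  by rewrite ler_pM2l.
apply/ler_addgt0Pr => e e0.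
set q := `|y - p| ^+ 2 / 2 in key.
have q0 : 0 <= q by rewrite divr_ge0// sqr_ge0.
(* chosen so that [t < 1] and [t * q <= e] *)
pose t := e / (e + q + 1).
have t01 : 0 < t < 1.
  rewrite /t divr_gt0//=; last lra.
  by rewrite ltr_pdivrMr; lra.
apply: le_trans (key t t01) _; rewrite lerD2l.
rewrite /t mulrAC ler_pdivrMr; last lra.
by rewrite ler_wpM2l//; lra.
Qed.

Lemma prox_subdifferential f x : Gamma0 f -> norm_minorized f ->
  subdifferential f (prox f x) (x - prox f x).
Proof.
move=> f0 fm; apply: argmin_prox_subdifferential => //.
by have [p hp] := argmin_prox_exists x f0 fm; exact: xgetI hp.
Qed.

End Prox.

(** * Riesz representation, adjoints and operator norms *)

Section Riesz.
Context {R : realType} {V : hilbertType R}.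

(** The prox of the linear functional [- phi] at the origin represents [phi]:
    its optimality condition is an inequality between linear functionals,
    hence an equality. *)
Lemma riesz (phi : V -> R) (C : R) :
    (forall (a : R) x y, phi (a *: x + y) = a * phi x + phi y) ->
    0 <= C -> (forall x, `|phi x| <= C * `|x|) ->
  exists u : V, forall x, phi x = inner x u.
Proof.
move=> philin C0 phiC.
have phiN x : phi (- x) = - phi x.
  have phi0 : phi 0 = 0.
    by have := philin 1 0 0; rewrite scale1r addr0 mul1r => ?; lra.
  by have := philin (-1) x 0; rewrite scaleN1r addr0 phi0 addr0 mulN1r.
have phiD x y : phi (x + y) = phi x + phi y.
  by have := philin 1 x y; rewrite scale1r mul1r.
have phi_cont : continuous phi.
  move=> x; apply/(@cvgrPdist_lt R R^o) => e e0; near=> t.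
  rewrite -phiN -phiD; apply: le_lt_trans (phiC _) _.
  have C1 : 0 < C + 1 by rewrite ltr_wpDl.
  apply: (@le_lt_trans _ _ ((C + 1) * `|x - t|)).
    by rewrite ler_wpM2r// lerDl.
  rewrite mulrC -ltr_pdivlMr//; near: t.
  apply: (@cvgr_dist_lt R V V (nbhs x) _ id x) => //.
  by rewrite divr_gt0// ltr_wpDl.
pose f (y : V) := (- phi y)%:E.
have f0 : Gamma0 f.
  split=> //.
  - move=> x a; rewrite /f lte_fin => ax.
    exists [set y | a < - phi y] => [|y /=]; last by rewrite lte_fin.
    exact: (cvgr_gt _ (@cvgN R R^o V _ _ phi _ (phi_cont x)) _ ax).
  - move=> x y t _.
    rewrite /f philin -[(1 - t) *: y]addr0 philin -!EFinM -EFinD lee_fin.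
    have -> : phi 0 = 0 by have := phiD 0 0; rewrite addr0 => ?; lra.
    by rewrite addr0 mulrN mulrN opprD.
  - by move=> x; rewrite ltNyr.
  - by exists 0; rewrite /dom/= ltry.
have fm : norm_minorized f.
  exists 0, C; split=> // y; rewrite lee_fin sub0r lerN2.
  exact: le_trans (ler_norm _) (phiC y).
have := prox_subdifferential 0 f0 fm; set p := prox f 0 => hp.
have hle d : phi d <= inner d p.
  have := hp (d + p); rewrite /f addrK sub0r innerNr -EFinD lee_fin phiD.
  by move=> ?; lra.
exists p => x; apply/eqP; rewrite eq_le hle /=.
by have := hle (- x); rewrite phiN innerNl lerN2.
Unshelve. all: by end_near. Qed.

End Riesz.

Section Adjoint.
Context {R : realType} {V W : hilbertType R} (L : {linear V -> W}).
Hypothesis L_bounded : bounded_fun_norm L.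

Lemma opnorm_ge0 : 0 <= opnorm L.
Proof.
have [M hM] := L_bounded 1.
apply: ub_le_sup; first by exists M => _ [x /= x1 <-]; exact: hM.
by exists 0 => /=; rewrite ?linear0 normr0.
Qed.

Lemma opnormP x : `|L x| <= opnorm L * `|x|.
Proof.
have [->|x0] := eqVneq x 0; first by rewrite linear0 !normr0 mulr0.
have [M hM] := L_bounded 1.
have nx : 0 < `|x| by rewrite normr_gt0.
rewrite -ler_pdivrMr// mulrC.
apply: ub_le_sup; first by exists M => _ [y /= y1 <-]; exact: hM.
exists (`|x|^-1 *: x) => /=.
  by rewrite normrZ ger0_norm ?invr_ge0// mulVf// gt_eqF.
by rewrite linearZ_LR normrZ ger0_norm ?invr_ge0.
Qed.

Lemma adjointP x y : inner (L x) y = inner x (adjoint L y).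
Proof.
have [|||u hu] := @riesz _ V (fun x => inner (L x) y) (opnorm L * `|y|).
- by move=> a u v; rewrite linearP innerDl innerZl.
- by rewrite mulr_ge0// opnorm_ge0.
- move=> u; apply: le_trans (normr_inner _ _) _.
  by rewrite mulrAC ler_wpM2r// opnormP.
- by move: x; exact: (@xgetI V 0 [set u' | forall x, _ = inner x u'] u hu).
Qed.

Lemma adjointB y y' : adjoint L (y - y') = adjoint L y - adjoint L y'.
Proof. by apply: inner_inj => x; rewrite innerBr -!adjointP innerBr. Qed.

(** With [u = L^* y], [|u|^2 = <L u, y>]. *)
Lemma adjoint_bound y : `|adjoint L y| <= opnorm L * `|y|.
Proof.
set u := adjoint L y.
have [->|u0] := eqVneq u 0; first by rewrite normr0 mulr_ge0 ?opnorm_ge0.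
have : `|u| * `|u| <= `|u| * (opnorm L * `|y|).
  rewrite -expr2 -inner_norm -adjointP.
  apply: le_trans (cauchy_schwarz _ _) _.
  by rewrite mulrA ler_wpM2r// mulrC opnormP.
by rewrite ler_pM2l// normr_gt0.
Qed.

End Adjoint.

(** * Conjugation and subgradients *)

Section Conjugate.
Context {R : realType} {V : hilbertType R}.
Implicit Types (f : V -> \bar R) (x y u : V).

Lemma fenchel_young f x u : ((inner x u)%:E - f x <= conjugate f u)%E.
Proof. by apply: ereal_sup_ubound; exists x. Qed.

Lemma dom_subgradient f x u : Gamma0 f -> subdifferential f x u -> dom f x.
Proof.
move=> [_ _ fNy [y0 fy0]] /(_ y0); move: fy0; rewrite /dom/=.
case: (f x) => [s| |] fy0; rewrite ?ltry ?ltNy0// addey// leye_eq => /eqP fy.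
by rewrite fy in fy0.
Qed.

Lemma fine_subgradient f x y u : Gamma0 f -> subdifferential f x u ->
  dom f y -> inner (y - x) u + fine (f x) <= fine (f y).
Proof.
move=> f0 fxu fy; have := fxu y.
by rewrite -(Gamma0_fineK f0 (dom_subgradient f0 fxu)) -(Gamma0_fineK f0 fy)
  -EFinD lee_fin.
Qed.

(** The equality case of the Fenchel-Young inequality. *)
Lemma conjugate_subgradient f x u : Gamma0 f -> subdifferential f x u ->
  conjugate f u = (inner x u - fine (f x))%:E.
Proof.
move=> f0 fxu; have fx := dom_subgradient f0 fxu.
apply/eqP; rewrite eq_le; apply/andP; split; last first.
  by rewrite EFinB (Gamma0_fineK f0 fx) fenchel_young.
apply: ge_ereal_sup => _ [y _ <-].
have [fy|] := pselect (dom f y); last first.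
  rewrite /dom/= => /negP; rewrite -leNgt leye_eq => /eqP ->.
  by rewrite addeNy leNye.
have := fine_subgradient f0 fxu fy.
rewrite -(Gamma0_fineK f0 fy) -EFinB lee_fin innerBl.
by move=> ?; lra.
Qed.

Lemma subdifferential_conjugate f x u : Gamma0 f -> subdifferential f x u ->
  subdifferential (conjugate f) u x.
Proof.
move=> f0 fxu u'; have fx := dom_subgradient f0 fxu.
rewrite (conjugate_subgradient f0 fxu) -EFinD.
apply: le_trans (fenchel_young f x u').
rewrite -{2}(Gamma0_fineK f0 fx) -EFinB lee_fin innerBl (innerC u') (innerC u).
by lra.
Qed.

(** A supremum of affine functions is convex and lower semicontinuous; the
    subgradient [u] provides a point where it is finite. *)
Lemma conjugate_Gamma0 f x u : Gamma0 f -> subdifferential f x u ->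
  Gamma0 (conjugate f).
Proof.
move=> f0 fxu; have fx := dom_subgradient f0 fxu; have [_ _ fNy _] := f0.
split.
- move=> v a /ereal_sup_gt[_ [y _ <-]].
  have [fy|] := pselect (dom f y); last first.
    rewrite /dom/= => /negP; rewrite -leNgt leye_eq => /eqP ->.
    by rewrite addeNy.
  rewrite -(Gamma0_fineK f0 fy) -EFinB lte_fin => ay.
  exists [set w | a + fine (f y) < inner y w].
    rewrite ltrBrDr in ay; exact: (cvgr_gt _ (@continuous_innerr _ _ y v) _ ay).
  move=> w /= aw; apply: lt_le_trans (fenchel_young f y w).
  by rewrite -(Gamma0_fineK f0 fy) -EFinB lte_fin; lra.
- move=> v w t /andP[t0 t1]; apply: ge_ereal_sup => _ [y _ <-].
  have [fy|] := pselect (dom f y); last first.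
    rewrite /dom/= => /negP; rewrite -leNgt leye_eq => /eqP ->.
    by rewrite addeNy leNye.
  have h (s : R) (v' : V) : 0 < s ->
      ((s * (inner y v' - fine (f y)))%:E <= s%:E * conjugate f v')%E.
    move=> s0; rewrite EFinM; apply: lee_wpmul2l; first by rewrite lee_fin ltW.
    by rewrite EFinB (Gamma0_fineK f0 fy) fenchel_young.
  apply: le_trans (leeD (h t v t0) (h (1 - t) w _)); last by rewrite subr_gt0.
  rewrite -(Gamma0_fineK f0 fy) -EFinB -EFinD lee_fin !innerE.
  by lra.
- move=> v; apply: lt_le_trans (fenchel_young f x v).
  by rewrite -(Gamma0_fineK f0 fx) -EFinB ltNyr.
- by exists u; rewrite /dom/= (conjugate_subgradient f0 fxu) ltry.
Qed.

Lemma subgradient_norm_minorized f x u : Gamma0 f -> subdifferential f x u ->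
  norm_minorized f.
Proof.
move=> f0 fxu; have fx := dom_subgradient f0 fxu.
exists (fine (f x) - inner x u), `|u|; split=> // y.
apply: le_trans (fxu y).
rewrite -(Gamma0_fineK f0 fx) -EFinD lee_fin innerBl.
have := normr_inner y u; rewrite ler_norml mulrC => /andP[? _]; lra.
Qed.

Lemma subdifferential_mono f x y u v : Gamma0 f ->
  subdifferential f x u -> subdifferential f y v -> 0 <= inner (x - y) (u - v).
Proof.
move=> f0 fxu fyv.
have := fine_subgradient f0 fxu (dom_subgradient f0 fyv).
have := fine_subgradient f0 fyv (dom_subgradient f0 fxu).
rewrite innerBr -(opprB x y) innerNl => *; lra.
Qed.

(** Strong convexity at a point makes the subdifferential strongly monotone at
    that point. The midpoint inequality suffices; letting the weight tend to 1
    would only double the constant. *)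
Lemma strongly_convex_mono f x : Gamma0 f -> strongly_convex_at f x ->
  exists2 rho : R, 0 < rho &
    forall y u v, subdifferential f x u -> subdifferential f y v ->
      rho * `|x - y| ^+ 2 <= inner (x - y) (u - v).
Proof.
move=> f0 [fx [rho rho0 hrho]]; exists (rho / 4); first by rewrite divr_gt0.
move=> y u v fxu fyv; have fy := dom_subgradient f0 fyv.
have h12 : 0 < (2^-1 : R) < 1 by apply/andP; split; lra.
have := hrho y 2^-1 fy h12.
have [fw _] := convex_fine f0 fx fy h12.
have := fine_subgradient f0 fyv fw.
have := fine_subgradient f0 fxu fy.
set w := _ + _ in fw *.
rewrite -(Gamma0_fineK f0 fw) -(Gamma0_fineK f0 fx) -(Gamma0_fineK f0 fy).
rewrite -!EFinM -!EFinD lee_fin.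
have -> : w - y = 2^-1 *: (x - y).
  rewrite /w scalerBr -addrA; congr (_ + _).
  by rewrite scalerBl scale1r addrAC subrr sub0r.
rewrite innerZl -(opprB x y) innerNl innerBr /=.
move: (inner (x - y) u) (inner (x - y) v) (`|x - y| ^+ 2) => a a' d.
move: (fine (f x)) (fine (f y)) (fine (f w)) => fX fY fW *.
by lra.
Qed.

(** The optimality condition of the scaled prox problem, divided by the scaling
    factor. *)
Lemma prox_conjugate_subdifferential f x u (gam : R) y : Gamma0 f ->
  subdifferential f x u -> 0 < gam ->
  let p := prox (fun v => (gam%:E * conjugate f v)%E) y in
  subdifferential (conjugate f) p (gam^-1 *: (y - p)).
Proof.
move=> f0 fxu g0; have := conjugate_Gamma0 f0 fxu.
have := subgradient_norm_minorized (conjugate_Gamma0 f0 fxu)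
  (subdifferential_conjugate f0 fxu).
set h := conjugate f => hm h0.
pose F v := (gam%:E * h v)%E.
have domF v : dom h v -> dom F v.
  by move=> hv; rewrite /dom/= /F -(Gamma0_fineK h0 hv) -EFinM ltry.
have F0 : Gamma0 F.
  have [lh ch hNy [v0 hv0]] := h0; split.
  - move=> v a; rewrite /F -lte_pdivrMl// -EFinM => /lh[W Wv hW].
    exists W => // v' /hW ahv'.
    by rewrite /F -lte_pdivrMl.
  - move=> v w t t01; rewrite /F.
    apply: le_trans (lee_wpmul2l _ (ch v w t t01)) _.
      by rewrite lee_fin ltW.
    move: t01 => /andP[t0 t1].
    move: (hNy v) (hNy w); rewrite /F.
    case: (h v) (h w) => [s| |] [s'| |] // _ _.
    + rewrite lee_fin; lra.
    + by rewrite !gt0_muley ?lte_fin ?subr_gt0// -!EFinM !addey// ?leey.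
    + by rewrite !gt0_muley ?lte_fin ?subr_gt0// -!EFinM !addye// ?leey.
    + by rewrite !gt0_muley ?lte_fin ?subr_gt0// ?leey.
  - move=> v; rewrite /F; have := hNy v.
    case: (h v) => [s| |] // _; first by rewrite -EFinM ltNyr.
    by rewrite gt0_muley ?lte_fin.
  - by exists v0; exact: domF.
have Fm : norm_minorized F.
  have [c [b [b0 hcb]]] := hm; exists (gam * c), (gam * b); split.
    by rewrite mulr_ge0// ltW.
  move=> v; rewrite /F -mulrA -mulrBr EFinM lee_wpmul2l ?lee_fin ?hcb//.
  exact: ltW.
have := prox_subdifferential y F0 Fm; rewrite /=; set p := prox F y => hp.
move=> v; have := hp v; rewrite /F innerZr.
have fp : dom h p.
  have := dom_subgradient F0 hp; have [_ _ hNy _] := h0; have := hNy p.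
  rewrite /dom/= /F; case: (h p) => [s| |] // _.
  by rewrite gt0_muley ?lte_fin.
have [fv|] := pselect (dom h v); last first.
  rewrite /dom/= => /negP; rewrite -leNgt leye_eq => /eqP -> _.
  by rewrite leey.
rewrite -(Gamma0_fineK h0 fp) -(Gamma0_fineK h0 fv) -!EFinM -!EFinD !lee_fin.
by rewrite -ler_pdivrMl// mulrDr mulKf// gt_eqF.
Qed.

Lemma prox_conjugate_nonexpansive f x u (gam : R) y y' : Gamma0 f ->
  subdifferential f x u -> 0 < gam ->
  `|prox (fun v => (gam%:E * conjugate f v)%E) y
    - prox (fun v => (gam%:E * conjugate f v)%E) y'| <= `|y - y'|.
Proof.
set P := prox _ => f0 fxu g0.
have := subdifferential_mono (conjugate_Gamma0 f0 fxu)
  (prox_conjugate_subdifferential y f0 fxu g0)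
  (prox_conjugate_subdifferential y' f0 fxu g0).
rewrite -/P -scalerBr innerZr pmulr_rge0 ?invr_gt0//.
have -> : y - P y - (y' - P y') = (y - y') - (P y - P y').
  by rewrite !opprB addrACA [- P y + _]addrC [RHS]addrACA.
rewrite innerBr inner_norm subr_ge0 => h.
have [->|PP] := eqVneq (P y - P y') 0; first by rewrite normr0.
rewrite -(@ler_pM2l _ `|P y - P y'|) ?normr_gt0// -expr2.
exact: le_trans h (cauchy_schwarz _ _).
Qed.

End Conjugate.

(** * Limits of sequences along filters *)

Lemma cvg_along (R : realType) (F : set_system nat) (u : nat -> R) (l : R) :
  \oo `<=` F -> u @ \oo --> l -> u @ F --> l.
Proof. by move=> oF ul U Ul; apply: oF; exact: ul. Qed.

Lemma cvg_sumr (R : realType) (m : nat) (F : set_system nat) {FF : Filter F}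
    (f : 'I_m -> nat -> R)
    (a : 'I_m -> R) :
  (forall i, f i n @[n --> F] --> a i) ->
  \sum_(i < m) f i n @[n --> F] --> \sum_(i < m) a i.
Proof. by move=> fa; apply: cvg_big => //; exact: add_continuous. Qed.

Lemma cvg0_sqr (R : realType) (F : set_system nat) {FF : ProperFilter F}
    (V : normedModType R) (f : nat -> V) (h : nat -> R) :
  (forall n, `|f n| ^+ 2 <= h n) -> h n @[n --> F] --> (0 : R) ->
  `|f n| @[n --> F] --> (0 : R).
Proof.
move=> fh h0; have : `|f n| ^+ 2 @[n --> F] --> (0 : R).
  apply: (@squeeze_cvgr _ _ _ _ (fun=> 0) h) => //; last exact: cvg_cst.
  by apply: nearW => n; rewrite sqr_ge0 fh.
move=> /(@continuous_cvg _ _ _ _ _ _ (@Num.sqrt R) _ (@sqrt_continuous R 0)).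
rewrite sqrtr0 (_ : _ \o _ = fun n => `|f n|)//.
by apply/funext => n /=; rewrite sqrtr_sqr normr_id.
Qed.

Lemma cvg_norm_bounded (R : realType) (u : nat -> R) :
  cvg (u @ \oo) -> exists M : R, forall n, `|u n| <= M.
Proof.
move=> /cvg_seq_bounded[M [_ hM]]; exists (M + 1) => n.
by apply: hM => //; rewrite ltrDl.
Qed.

(** * Weak sequential compactness through ultrafilters *)

Section Ultrafilters.
Context {R : realType}.

(** Compactness of the segment gives a cluster point, and an ultrafilter
    converges to its cluster points. *)
Lemma ultra_cvg (T : Type) (F : set_system T) (u : T -> R) (M : R) :
  UltraFilter F -> (forall n, `|u n| <= M) -> exists l : R, u @ F --> l.
Proof.
move=> FU uM.
have uF : F (u @^-1` `[- M, M]%classic).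
  by apply: filterE => n /=; rewrite in_itv /= -ler_norml.
have [l [_ ul]] := @segment_compact R (- M) M (u @ F) _ uF.
exists l => U Ul.
have [//|FnU] := in_ultra_setVsetC (u @^-1` U) FU.
by have [x [+ Ux]] := ul (~` U) U FnU Ul => /(_ Ux).
Qed.

(** A bad neighbourhood of [l] would be avoided along an infinite set of
    indices, hence along some ultrafilter containing this set. *)
Lemma cvg_ultra (u : nat -> R) (l : R) :
  (forall F, UltraFilter F -> \oo `<=` F -> u @ F --> l) -> u @ \oo --> l.
Proof.
move=> uF U Ul; apply: contrapT => nU.
have FP : ProperFilter (within (~` (u @^-1` U)) \oo).
  apply: Build_ProperFilter; rewrite /within /= => h; apply: nU.
  rewrite /fmap /= /nbhs /=.
  by apply: filterS h => n /= hn; apply: contrapT => /hn.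
have [G [GU FG]] := ultraFilterLemma FP.
have oG : \oo `<=` G by move=> A oA; apply: FG; apply: filterS oA.
have GnU : G (~` (u @^-1` U)).
  by apply: FG; rewrite /within /=; exact: nearW.
have GUU : G (u @^-1` U) := uF G GU oG U Ul.
by have [x []] := filter_ex (filterI GnU GUU).
Qed.

End Ultrafilters.

Section WeakLimits.
Context {R : realType} {V : hilbertType R}.

(** Weak convergence along an arbitrary filter of indices; along [\oo] it is
    [weak_cvg]. *)
Definition weak_lim (F : set_system nat) (u : nat -> V) (l : V) :=
  forall y : V, inner (u n) y @[n --> F] --> (inner l y : R).

(** The scalar limits along the ultrafilter form a bounded linear functional,
    which the Riesz theorem represents. *)
Lemma ultra_weak_lim (F : set_system nat) (u : nat -> V) (M : R) :
  UltraFilter F -> (forall n, `|u n| <= M) -> exists l, weak_lim F u l.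
Proof.
move=> FU uM.
have M0 : 0 <= M := le_trans (normr_ge0 _) (uM 0).
have uyM y n : `|inner (u n) y| <= M * `|y|.
  by apply: le_trans (normr_inner _ _) _; rewrite ler_wpM2r.
have /choice[phi hphi] : forall y, exists l : R, inner (u n) y @[n --> F] --> l.
  by move=> y; exact: ultra_cvg (uyM y).
have [||x|l hl] := @riesz _ V phi M; last 1 first.
- exists l => y; rewrite innerC -hl; exact: hphi.
- move=> a x y.
  have h1 : inner (u n) (a *: x + y) @[n --> F] --> (a * phi x + phi y : R).
    under eq_fun do rewrite innerDr innerZr.
    by apply: cvgD => //; apply: cvgM => //; exact: cvg_cst.
  exact: (cvg_unique _ (hphi _) h1).
- exact: M0.
- have : `|inner (u n) x| @[n --> F] --> `|phi x| by apply: cvg_norm.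
  move=> h; rewrite -(cvg_lim (@Rhausdorff R) h); apply: limr_le.
    by apply/cvg_ex; eexists; exact: h.
  exact: nearW.
Qed.

Lemma weak_lim_strong (F : set_system nat) {FF : ProperFilter F}
    (u e : nat -> V) (l : V) :
  weak_lim F u l -> `|e n| @[n --> F] --> (0 : R) ->
  weak_lim F (fun n => u n + e n) l.
Proof.
move=> ul e0 y; under eq_fun do rewrite innerDl.
rewrite -[inner l y]addr0; apply: cvgD => //; apply: norm_cvg0.
apply: (@squeeze_cvgr _ _ _ _ (fun=> 0) (fun n => `|e n| * `|y|)).
- by apply: nearW => n; rewrite normr_ge0 normr_inner.
- exact: cvg_cst.
- by rewrite -(mul0r `|y|); apply: cvgM => //; exact: cvg_cst.
Qed.

Lemma cvg_inner_strong (F : set_system nat) {FF : ProperFilter F}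
    (u e : nat -> V) (M : R) :
  (forall n, `|u n| <= M) -> `|e n| @[n --> F] --> (0 : R) ->
  inner (u n) (e n) @[n --> F] --> (0 : R).
Proof.
move=> uM e0; apply: norm_cvg0.
apply: (@squeeze_cvgr _ _ _ _ (fun=> 0) (fun n => M * `|e n|)).
- apply: nearW => n; rewrite normr_ge0 /=.
  by apply: le_trans (normr_inner _ _) _; rewrite ler_wpM2r.
- exact: cvg_cst.
- by rewrite -(mulr0 M); apply: cvgM => //; exact: cvg_cst.
Qed.

End WeakLimits.

(** * Quasi-Fejer sequences of real numbers *)

Section QuasiFejer.
Context {R : realType}.

(** For nonnegative terms this is summability; in this form sums and multiples
    of summable sequences are immediate. *)
Definition bounded_sums (t : nat -> R) :=
  exists C : R, forall N, \sum_(0 <= n < N) t n <= C.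

Lemma abs_summable_bounded_sums (V : normedModType R) (a : nat -> V) :
  abs_summable a -> bounded_sums (fun n => `|a n|).
Proof.
rewrite /abs_summable => ha.
set s := (\sum_(_ <= _ <oo) _)%E in ha.
have s0 : (0 <= s)%E by apply: nneseries_ge0.
exists (fine s) => N.
rewrite -lee_fin fineK ?ge0_fin_numE// -sumEFin.
exact: nneseries_lim_ge.
Qed.

Lemma bounded_sumsD (s t : nat -> R) :
  bounded_sums s -> bounded_sums t -> bounded_sums (fun n => s n + t n).
Proof.
by move=> [C hC] [D hD]; exists (C + D) => N; rewrite big_split lerD.
Qed.

Lemma bounded_sumsZ (k : R) (t : nat -> R) : 0 <= k ->
  bounded_sums t -> bounded_sums (fun n => k * t n).
Proof.
by move=> k0 [C hC]; exists (k * C) => N; rewrite -mulr_sumr ler_wpM2l.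
Qed.

Lemma bounded_sums_sum (m : nat) (t : 'I_m -> nat -> R) :
  (forall i, bounded_sums (t i)) -> bounded_sums (fun n => \sum_(i < m) t i n).
Proof.
move=> /choice[C hC]; exists (\sum_(i < m) C i) => N.
by rewrite exchange_big; apply: ler_sum => i _; exact: hC.
Qed.

Lemma bounded_sums_cvg0 (t : nat -> R) : (forall n, 0 <= t n) ->
  bounded_sums t -> cvg (series t @ \oo) /\ t @ \oo --> (0 : R).
Proof.
move=> t0 [C hC]; suff h : cvg (series t @ \oo).
  by split=> //; exact: cvg_series_cvg_0.
apply: nondecreasing_is_cvgn.
  by apply/nondecreasing_seqP => n; rewrite /series /= big_nat_recr//= lerDl.
by exists C => _ [n _ <-]; exact: hC.
Qed.

Lemma bounded_sums_ub (t : nat -> R) : (forall n, 0 <= t n) ->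
  bounded_sums t -> exists C, forall n, t n <= C.
Proof.
move=> t0 [C hC]; exists C => n; apply: le_trans (hC n.+1).
by rewrite big_nat_recr//= lerDr sumr_ge0.
Qed.

(** Since [1 + th n <= exp (th n)], dividing [E n] by the exponential of the
    partial sums of [th] makes it nonincreasing. *)
Lemma quasi_fejer (E d th : nat -> R) :
  (forall n, 0 <= E n) -> (forall n, 0 <= d n) -> (forall n, 0 <= th n) ->
  bounded_sums th ->
  (forall n, E n.+1 <= (1 + th n) * (E n - d n)) ->
  cvg (E @ \oo) /\ d @ \oo --> (0 : R).
Proof.
move=> E0 d0 th0 ths hE.
have [Scvg thcvg] := bounded_sums_cvg0 th0 ths.
pose T n := E n * expR (- series th n).
have Tcvg : cvg (T @ \oo).
  apply: nonincreasing_is_cvgn; last first.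
    by exists 0 => _ [n _ <-]; rewrite mulr_ge0// expR_ge0.
  apply/nonincreasing_seqP => n; rewrite /T /series /= big_nat_recr//=.
  rewrite opprD expRD mulrCA mulrC ler_wpM2r ?expR_ge0//.
  apply: (@le_trans _ _ ((1 + th n) * E n * expR (- th n))).
    rewrite ler_wpM2r ?expR_ge0//; apply: le_trans (hE n) _.
    by rewrite ler_wpM2l ?addr_ge0// gerBl.
  rewrite expRN ler_pdivrMr ?expR_gt0// mulrC ler_wpM2l//.
  exact: expR_ge1Dx.
have Ecvg : cvg (E @ \oo).
  have -> : E = (fun n => T n * expR (series th n)).
    by apply/funext => n; rewrite /T -mulrA -expRD addNr expR0 mulr1.
  apply: is_cvgM => //; apply/cvg_ex; exists (expR (lim (series th @ \oo))).
  apply: (@continuous_cvg _ _ _ _ _ (series th) expR) => //.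
  exact: continuous_expR.
split=> //.
apply: (@squeeze_cvgr _ _ _ _ (fun=> 0) (fun n => E n - E n.+1 + th n * E n)).
- apply: nearW => n; rewrite d0/=; have := hE n.
  have := mulr_ge0 (th0 n) (d0 n).
  by move=> *; lra.
- exact: cvg_cst.
- set l := lim (E @ \oo).
  have El : E @ \oo --> l by exact: Ecvg.
  have -> : (0 : R) = l - l + 0 * l by rewrite subrr mul0r addr0.
  apply: cvgD; last by apply: cvgM.
  by apply: cvgB => //; rewrite cvg_shiftS.
Qed.

End QuasiFejer.

(** * Optimality conditions of the composite problem *)

Section CompositeProblem.
Context {R : realType} {H : hilbertType R} {m : nat} (z : H) (omega : 'I_m -> R)
  {G : 'I_m -> hilbertType R} (r : forall i, G i) (g : forall i, G i -> \bar R)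
  (L : forall i, {linear H -> G i}).
Arguments r : clear implicits.
Arguments g : clear implicits.
Arguments L : clear implicits.
Hypothesis omega_gt0 : forall i, 0 < omega i.
Hypothesis omega_sum1 : \sum_(i < m) omega i = 1.
Hypothesis g_Gamma0 : forall i, Gamma0 (g i).
Hypothesis L_bounded : forall i, bounded_fun_norm (L i).

(** The primal-dual optimality system; for the algorithm, the zeros of the sum
    of a maximally monotone operator and the skew operator
    [(x, v) |-> (L^* v, - L x)]. *)
Definition kkt (x : H) (v : forall i, G i) :=
  (forall i, subdifferential (g i) (L i x - r i) (v i)) /\
  \sum_(i < m) omega i *: adjoint (L i) (v i) = z.

Lemma inner_sum_adjoint (y : H) (v : forall i, G i) :
  inner y (\sum_(i < m) omega i *: adjoint (L i) (v i)) =
  \sum_(i < m) omega i * inner (L i y) (v i).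
Proof.
by rewrite inner_sumr; apply: eq_bigr => i _; rewrite innerZr -adjointP.
Qed.

(** The weighted subgradient inequalities at [x] add up to a linear term
    [<y - x | sum omega_i L_i^* v_i>], which the term [- <y | z>] cancels. *)
Lemma kkt_primal x v : kkt x v -> primal_solution z omega r g L x.
Proof.
move=> [gxv Lvz]; split=> // y _; rewrite /primal_objective.
pose c i := fine (g i (L i x - r i)).
have gc i : g i (L i x - r i) = (c i)%:E.
  by rewrite /c Gamma0_fineK//; exact: dom_subgradient (gxv i).
under eq_bigr do rewrite gc -EFinM.
rewrite sumEFin.
apply: (@le_trans _ _ (\sum_(i < m)
    (omega i * (inner (L i y - L i x) (v i) + c i))%:E - (inner y z)%:E)%E).
  rewrite sumEFin -!EFinB lee_fin.
  under [in leRHS]eq_bigr do rewrite mulrDr.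
  rewrite big_split /=.
  have -> : \sum_(i < m) omega i * inner (L i y - L i x) (v i)
      = inner (y - x) z.
    rewrite -Lvz inner_sum_adjoint; apply: eq_bigr => i _.
    by rewrite (linearB (L i)).
  by rewrite innerBl; lra.
apply: leeB => //; apply: lee_sum => i _.
rewrite EFinM; apply: lee_wpmul2l; first by rewrite lee_fin ltW.
have := gxv i (L i y - r i); rewrite gc -EFinD.
by have -> : L i y - r i - (L i x - r i) = L i y - L i x
  by rewrite opprB addrA subrK.
Qed.

(** The Fenchel-Young lower bound at [L x - r] takes the same value at all
    feasible points, and is attained at [v]. *)
Lemma kkt_dual x v : kkt x v -> dual_solution z omega r g L v.
Proof.
move=> [gxv Lvz]; split=> // w Lwz; rewrite /dual_objective.
pose c i := fine (g i (L i x - r i)).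
have gc i : g i (L i x - r i) = (c i)%:E.
  by rewrite /c Gamma0_fineK//; exact: dom_subgradient (gxv i).
pose lb (u : forall i, G i) := \sum_(i < m)
  omega i * (inner (L i x - r i) (u i) - c i + inner (u i) (r i)).
have lbE u : \sum_(i < m) omega i *: adjoint (L i) (u i) = z ->
    lb u = inner x z - \sum_(i < m) omega i * c i.
  move=> <-; rewrite inner_sum_adjoint -sumrB; apply: eq_bigr => i _.
  by rewrite innerBl (innerC (u i)); ring.
apply: (@le_trans _ _ (lb v)%:E).
  rewrite /lb -sumEFin le_eqVlt; apply/orP; left; apply/eqP.
  apply: eq_bigr => i _.
  by rewrite (conjugate_subgradient (g_Gamma0 i) (gxv i)) -EFinD -EFinM.
rewrite (lbE _ Lvz) -(lbE _ Lwz) /lb -sumEFin; apply: lee_sum => i _.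
rewrite EFinM; apply: lee_wpmul2l; first by rewrite lee_fin ltW.
rewrite EFinD; apply: leeD => //.
by rewrite EFinB -gc fenchel_young.
Qed.

(** Optimality conditions perturbed by residuals [e1] and [e2], with the
    inclusion in terms of the conjugates: this is what one step of the
    algorithm provides at the point [(p, q)]. *)
Definition perturbed_kkt (e1 : H) (e2 : forall i, G i) (p : H)
    (q : forall i, G i) :=
  (forall i, subdifferential (conjugate (g i)) (q i) (e2 i - r i + L i p)) /\
  \sum_(i < m) omega i *: adjoint (L i) (q i) = z + e1.

(** The coupling terms [<L_i p, q_i>] and [<p, L_i^* q_i>] cancel, so that only
    the residuals remain in the monotonicity gap. *)
Lemma kkt_gap e1 e2 p q x v : perturbed_kkt e1 e2 p q -> kkt x v ->
  \sum_(i < m) omega i * inner (q i - v i)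
     ((e2 i - r i + L i p) - (L i x - r i)) =
  inner e1 (p - x) + \sum_(i < m) omega i * inner (e2 i) (q i - v i).
Proof.
move=> [_ Lq] [_ Lv].
have -> : inner e1 (p - x) =
    \sum_(i < m) omega i * inner (L i (p - x)) (q i - v i).
  have -> : e1 = \sum_(i < m) omega i *: adjoint (L i) (q i)
               - \sum_(i < m) omega i *: adjoint (L i) (v i).
    by rewrite Lq Lv addrAC subrr add0r.
  rewrite innerC innerBr !inner_sum_adjoint -sumrB; apply: eq_bigr => i _.
  by rewrite innerBr mulrBr.
rewrite -big_split /=; apply: eq_bigr => i _.
rewrite -mulrDr -innerDl [in RHS]innerC.
by rewrite (linearB (L i)) opprB addrACA subrK addrC.
Qed.

Lemma kkt_gap_ge0 e1 e2 p q x v : perturbed_kkt e1 e2 p q -> kkt x v ->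
  0 <= inner e1 (p - x) + \sum_(i < m) omega i * inner (e2 i) (q i - v i).
Proof.
move=> pq xv; rewrite -(kkt_gap pq xv); apply: sumr_ge0 => i _.
rewrite mulr_ge0 ?(ltW (omega_gt0 i))//.
apply: subdifferential_mono (pq.1 i) _; last first.
  exact: subdifferential_conjugate (xv.1 i).
exact: conjugate_Gamma0 (xv.1 i).
Qed.

(** Weak limits of points with vanishing residuals are solutions. Although
    [p n] and [q i n] converge only weakly, the coupling
    [sum omega_i <L_i (p n), q i n>] has a limit, since the perturbed linear
    constraint makes it [<p n, z + e1 n>]. The monotonicity inequalities thus
    pass to the limit. Testing them at the graph points [(s i, a i)] given by
    the prox of [g i] at [w i + v i] forces [s i = w i] and [a i = v i]. *)
Lemma perturbed_kkt_limit (F : set_system nat) {FF : ProperFilter F}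
    (e1 : nat -> H) (e2 : forall i, nat -> G i) (p : nat -> H)
    (q : forall i, nat -> G i) (M : R) (x : H) (v : forall i, G i) :
  (forall i, exists s u, subdifferential (g i) s u) ->
  (forall n, perturbed_kkt (e1 n) (e2^~ n) (p n) (q^~ n)) ->
  (forall n, `|p n| <= M) -> (forall i n, `|q i n| <= M) ->
  `|e1 n| @[n --> F] --> (0 : R) ->
  (forall i, `|e2 i n| @[n --> F] --> (0 : R)) ->
  weak_lim F p x -> (forall i, weak_lim F (q i) (v i)) ->
  kkt x v.
Proof.
move=> gsub pq pM qM e10 e20 px qv.
have Lvz : \sum_(i < m) omega i *: adjoint (L i) (v i) = z.
  apply: inner_inj => y; rewrite inner_sum_adjoint.
  have h1 : \sum_(i < m) omega i * inner (q i n) (L i y) @[n --> F] -->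
      \sum_(i < m) omega i * inner (v i) (L i y).
    by apply: cvg_sumr => i; apply: cvgM; [exact: cvg_cst|exact: qv].
  have h2 : \sum_(i < m) omega i * inner (q i n) (L i y) @[n --> F] -->
      (inner z y : R).
    have -> : (fun n => \sum_(i < m) omega i * inner (q i n) (L i y)) =
        (fun n => inner (z + e1 n) y).
      apply/funext => n; rewrite -(pq n).2 innerC inner_sum_adjoint.
      by apply: eq_bigr => i _; rewrite innerC.
    apply: (@weak_lim_strong _ _ F FF (fun=> z) e1 z) => // w.
    exact: cvg_cst.
  rewrite (innerC y) -(cvg_unique (@Rhausdorff R) h1 h2).
  by apply: eq_bigr => i _; rewrite innerC.
split=> // j.
pose w i := L i x - r i.
pose s i := prox (g i) (w i + v i).
pose a i := w i + v i - s i.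
have sa i : subdifferential (g i) (s i) (a i).
  have [s0 [u0 su0]] := gsub i.
  exact: prox_subdifferential (subgradient_norm_minorized (g_Gamma0 i) su0).
pose gap n := \sum_(i < m)
  omega i * inner (q i n - a i) ((e2 i n - r i + L i (p n)) - s i).
have gap0 n : 0 <= gap n.
  apply: sumr_ge0 => i _; rewrite mulr_ge0 ?(ltW (omega_gt0 i))//.
  apply: subdifferential_mono ((pq n).1 i) _; last first.
    exact: subdifferential_conjugate (sa i).
  exact: conjugate_Gamma0 (sa i).
have gapE n : gap n =
    (inner (p n) z + inner (p n) (e1 n)) +
    \sum_(i < m) omega i * (inner (q i n - a i) (e2 i n)
       - inner (q i n - a i) (r i + s i) - inner (p n) (adjoint (L i) (a i))).
  rewrite -innerDr -(pq n).2 inner_sum_adjoint -big_split /=.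
  apply: eq_bigr => i _; rewrite -mulrDr; congr (_ * _).
  rewrite -adjointP//; move: (a i) (s i) => ai si.
  by rewrite !innerE (innerC _ (q i n)) (innerC _ ai); ring.
have gap_cvg : gap n @[n --> F] --> ((inner x z + 0) + \sum_(i < m) omega i *
    (0 - inner (v i - a i) (r i + s i) - inner x (adjoint (L i) (a i)))).
  rewrite (funext gapE).
  apply: cvgD.
    apply: cvgD; first exact: px.
    exact: cvg_inner_strong pM e10.
  apply: cvg_sumr => i; apply: cvgM; first exact: cvg_cst.
  apply: cvgB; last exact: px.
  apply: cvgB.
    apply: (@cvg_inner_strong _ _ _ _ _ _ (M + `|a i|)) => // n.
    by rewrite (le_trans (ler_normB _ _))// lerD2r.
  under eq_fun do rewrite innerBl.
  by rewrite innerBl; apply: cvgB; [exact: qv|exact: cvg_cst].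
have sw0 : \sum_(i < m) omega i * `|w i - s i| ^+ 2 <= 0.
  have : 0 <= lim (gap n @[n --> F]).
    apply: limr_ge; first by apply/cvg_ex; eexists; exact: gap_cvg.
    exact: nearW.
  rewrite (cvg_lim (@Rhausdorff R) gap_cvg)//.
  rewrite -{1}Lvz inner_sum_adjoint addr0 -big_split /= -oppr_le0 -sumrN.
  congr (_ <= _); apply: eq_bigr => i _.
  rewrite -mulrDr -mulrN; congr (_ * _).
  rewrite -adjointP// /a /w -inner_norm.
  move: (L i x) (r i) (s i) (v i) => A B S U; rewrite !innerE.
  rewrite ?(innerC S A) ?(innerC B A) ?(innerC B S) ?(innerC U A) ?(innerC U B).
  by rewrite ?(innerC U S); ring.
have wsj : w j = s j.
  apply/eqP; rewrite -subr_eq0 -normr_eq0 -sqrf_eq0.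
  have pos i : 0 <= omega i * `|w i - s i| ^+ 2.
    by rewrite mulr_ge0 ?sqr_ge0// ltW.
  have /eqP : \sum_(i < m) omega i * `|w i - s i| ^+ 2 = 0.
    by apply/eqP; rewrite eq_le sw0 sumr_ge0.
  rewrite psumr_eq0// => /allP/(_ j (mem_index_enum _))/=.
  by rewrite mulf_eq0 gt_eqF//=.
by have := sa j; rewrite /a -wsj addrAC subrr add0r.
Qed.

(** Strong monotonicity at [v i] bounds [|q i n - v i|^2] by a multiple of the
    gap of [kkt_gap], which tends to 0 with the residuals. *)
Lemma perturbed_kkt_strong_limit (F : set_system nat) {FF : ProperFilter F}
    (e1 : nat -> H) (e2 : forall i, nat -> G i) (p : nat -> H)
    (q : forall i, nat -> G i) (M : R) (x : H) (v : forall i, G i) :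
  (forall n, perturbed_kkt (e1 n) (e2^~ n) (p n) (q^~ n)) ->
  (forall n, `|p n| <= M) -> (forall i n, `|q i n| <= M) ->
  `|e1 n| @[n --> F] --> (0 : R) ->
  (forall i, `|e2 i n| @[n --> F] --> (0 : R)) ->
  kkt x v -> (forall i, strongly_convex_at (conjugate (g i)) (v i)) ->
  forall i, `|q i n - v i| @[n --> F] --> (0 : R).
Proof.
move=> pq pM qM e10 e20 xv vsc j.
pose gap n :=
  inner (p n - x) (e1 n) + \sum_(i < m) omega i * inner (q i n - v i) (e2 i n).
have gap_cvg : gap @ F --> (0 : R).
  have -> : (0 : R) = 0 + \sum_(i < m) omega i * 0.
    by rewrite big1 ?addr0// => i _; rewrite mulr0.
  apply: cvgD; last (apply: cvg_sumr => i; apply: cvgM; first exact: cvg_cst).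
  - apply: (@cvg_inner_strong _ _ _ _ _ _ (M + `|x|)) => // n.
    by rewrite (le_trans (ler_normB _ _))// lerD2r.
  - apply: (@cvg_inner_strong _ _ _ _ _ _ (M + `|v i|)) => // n.
    by rewrite (le_trans (ler_normB _ _))// lerD2r.
have conj0 i : Gamma0 (conjugate (g i)).
  exact: conjugate_Gamma0 (xv.1 i).
have vx i : subdifferential (conjugate (g i)) (v i) (L i x - r i).
  exact: subdifferential_conjugate (xv.1 i).
have [rho rho0 hrho] := strongly_convex_mono (conj0 j) (vsc j).
have orho : 0 < omega j * rho by rewrite mulr_gt0.
have qv_gap n : `|q j n - v j| ^+ 2 <= (omega j * rho)^-1 * gap n.
  rewrite ler_pdivlMl// /gap innerC.
  under eq_bigr do rewrite innerC.
  rewrite -(kkt_gap (pq n) xv) (bigD1 j)//= -mulrA -[leLHS]addr0.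
  apply: lerD; last first.
    apply: sumr_ge0 => i _; rewrite mulr_ge0 ?(ltW (omega_gt0 i))//.
    exact: subdifferential_mono ((pq n).1 i) (vx i).
  rewrite ler_pM2l// distrC (le_trans (hrho _ _ _ (vx j) ((pq n).1 j)))//.
  by rewrite -(opprB (q j n)) innerNl -innerNr opprB.
apply: (@cvg0_sqr _ _ _ _ _ _ qv_gap).
by rewrite -(mulr0 (omega j * rho)^-1); apply: cvgM => //; exact: cvg_cst.
Qed.

(** * The inexact forward-backward-forward iteration *)


Definition sqdist (x x' : 'I_m -> H) (v v' : forall i, G i) : R :=
  \sum_(i < m) omega i * (`|x i - x' i| ^+ 2 + `|v i - v' i| ^+ 2).

Lemma sqdist_ge0 x x' v v' : 0 <= sqdist x x' v v'.
Proof.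
by apply: sumr_ge0 => i _; rewrite mulr_ge0 ?addr_ge0 ?sqr_ge0// ltW.
Qed.

Lemma sqdist_term x x' v v' (i : 'I_m) :
  `|x i - x' i| ^+ 2 <= (omega i)^-1 * sqdist x x' v v' /\
  `|v i - v' i| ^+ 2 <= (omega i)^-1 * sqdist x x' v v'.
Proof.
have h : omega i * (`|x i - x' i| ^+ 2 + `|v i - v' i| ^+ 2)
    <= sqdist x x' v v'.
  rewrite /sqdist (bigD1 i)//= lerDl; apply: sumr_ge0 => j _.
  by rewrite mulr_ge0 ?addr_ge0 ?sqr_ge0// ltW.
rewrite !ler_pdivlMl//.
by split; apply: le_trans h; rewrite ler_wpM2l ?(ltW (omega_gt0 i))//
  ?lerDl ?lerDr ?sqr_ge0.
Qed.

(** The perturbation is expanded with [2 a h <= h + a^2 h], which keeps the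
    estimate multiplicative in [1 + sqdist] and so needs no triangle inequality
    for the weighted norm. *)
Lemma sqdist_perturb (x x' b : 'I_m -> H) (v v' c : forall i, G i) (h : R) :
  0 <= h -> (forall i, `|x' i - x i| <= h) -> (forall i, `|v' i - v i| <= h) ->
  1 + sqdist x' b v' c <= (1 + (2 * h + 2 * h ^+ 2)) * (1 + sqdist x b v c).
Proof.
move=> h0 xh vh.
have tri (W : hilbertType R) (w w' d : W) : `|w' - w| <= h ->
    `|w' - d| ^+ 2 <= (1 + h) * `|w - d| ^+ 2 + (h + h ^+ 2).
  move=> wh; have : `|w' - d| <= `|w - d| + h.
    have -> : w' - d = (w - d) + (w' - w)
      by rewrite [RHS]addrC [RHS]addrA subrK.
    by apply: le_trans (ler_normD _ _) _; rewrite lerD2l.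
  move: (`|w' - d|) (`|w - d|) (normr_ge0 (w' - d)) (normr_ge0 (w - d)).
  move=> s t s0 t0 st.
  have : s ^+ 2 <= (t + h) ^+ 2 by rewrite ler_sqr ?nnegrE ?addr_ge0.
  have := mulr_ge0 h0 (sqr_ge0 (t - 1)); rewrite sqrrB sqrrD => *; lra.
have : sqdist x' b v' c <= (1 + h) * sqdist x b v c + (2 * h + 2 * h ^+ 2).
  have -> : 2 * h + 2 * h ^+ 2 = \sum_(i < m) omega i * (2 * h + 2 * h ^+ 2).
    by rewrite -mulr_suml omega_sum1 mul1r.
  rewrite /sqdist mulr_sumr -big_split /=; apply: ler_sum => i _.
  rewrite mulrCA -mulrDr ler_wpM2l ?(ltW (omega_gt0 i))//.
  have := tri _ _ _ (b i) (xh i); have := tri _ _ _ (c i) (vh i).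
  by move=> *; lra.
have := mulr_ge0 h0 (sqdist_ge0 x b v c).
have := mulr_ge0 (sqr_ge0 h) (sqdist_ge0 x b v c).
by move: (sqdist x b v c) (sqdist x' b v' c) => s s' *; lra.
Qed.

(** The second forward step of the method, which turns the forward-backward
    point [(p, q)] into the next iterate. *)
Definition correct_x (gam : R) (v q : forall i, G i) (p : H) (i : 'I_m) : H :=
  p + gam *: (adjoint (L i) (v i) - adjoint (L i) (q i)).

Definition correct_v (gam : R) (x : 'I_m -> H) (p : H) (q : forall i, G i)
    (i : 'I_m) : G i :=
  q i + gam *: (L i p - L i (x i)).

Section Step.
Variables (gam beta : R) (x : 'I_m -> H) (v : forall i, G i).
Variables (p : H) (q : forall i, G i).
Hypothesis gam_gt0 : 0 < gam.
Hypothesis beta_ge0 : 0 <= beta.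
Hypothesis L_beta : forall i, opnorm (L i) <= beta.
Hypothesis p_def :
  p = \sum_(i < m) omega i *: (x i - gam *: adjoint (L i) (v i)) + gam *: z.
Hypothesis q_sub : forall i, subdifferential (conjugate (g i)) (q i)
  (gam^-1 *: (v i + gam *: L i (x i) - gam *: r i - q i)).

Let x' := correct_x gam v q p.
Let v' := correct_v gam x p q.
Let e1 := gam^-1 *: \sum_(i < m) omega i *: (x i - x' i).
Let e2 i := gam^-1 *: (v i - v' i).

(** The residuals of the forward-backward point are the displacement of the
    full step divided by the step size, averaged over the copies of [H] in the
    first component. *)
Lemma step_perturbed_kkt : perturbed_kkt e1 e2 p q.
Proof.
have gam0 : gam != 0 by rewrite gt_eqF.
split=> [i|].
  suff -> : e2 i - r i + L i p =
     gam^-1 *: (v i + gam *: L i (x i) - gam *: r i - q i) by exact: q_sub.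
  by apply: inner_inj => y; rewrite /e2 /v' /correct_v !innerE; field.
apply: inner_inj => y; rewrite /e1 /x' /correct_x innerDr innerZr !inner_sumr.
pose s := \sum_(i < m) omega i *
  (inner y (x i) - gam * inner y (adjoint (L i) (v i))).
pose t := \sum_(i < m) omega i * inner y (adjoint (L i) (q i)).
have py : inner y p = s + gam * inner y z.
  rewrite p_def innerDr inner_sumr innerZr; congr (_ + _).
  by apply: eq_bigr => i _; rewrite !innerE; ring.
have -> : \sum_(i < m) inner y (omega i *: adjoint (L i) (q i)) = t.
  by apply: eq_bigr => i _; rewrite innerZr.
have -> : \sum_(i < m) inner y (omega i *: (x i -
    (p + gam *: (adjoint (L i) (v i) - adjoint (L i) (q i))))) =
    s - inner y p + gam * t.
  rewrite -[inner y p]mul1r -omega_sum1 mulr_suml mulr_sumr -sumrB -big_split.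
  by apply: eq_bigr => i _; rewrite /= !innerE; ring.
by rewrite py; field.
Qed.

Lemma correct_x_dist i : `|x' i - p| <= gam * beta * `|v i - q i|.
Proof.
rewrite /x' /correct_x addrAC subrr add0r -adjointB// normrZ gtr0_norm//.
rewrite -mulrA ler_wpM2l ?(ltW gam_gt0)//.
by apply: le_trans (adjoint_bound _ _) _; rewrite ?ler_wpM2r.
Qed.

Lemma correct_v_dist i : `|v' i - q i| <= gam * beta * `|x i - p|.
Proof.
rewrite /v' /correct_v addrAC subrr add0r -linearB normrZ gtr0_norm//.
rewrite -mulrA ler_wpM2l ?(ltW gam_gt0)// distrC.
by apply: le_trans (opnormP _ _) _; rewrite ?ler_wpM2r.
Qed.

(** The monotonicity of the subdifferentials makes the inner products in the
    three-point identities add up to a nonnegative quantity, and the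
    correction moves [(p, q)] by at most [gam * beta] times the distance from
    [(x, v)] to [(p, q)]. *)
Lemma fejer_step xb vb : kkt xb vb ->
  sqdist x' (fun=> xb) v' vb +
    (1 - (gam * beta) ^+ 2) * sqdist x (fun=> p) v q
  <= sqdist x (fun=> xb) v vb.
Proof.
move=> k.
pose T := \sum_(i < m) omega i * (inner (x i - x' i) (p - xb)
                                  + inner (v i - v' i) (q i - vb i)).
have T0 : 0 <= T.
  have := kkt_gap_ge0 step_perturbed_kkt k.
  rewrite -(pmulr_rge0 _ gam_gt0); congr (_ <= _).
  rewrite mulrDr /e1 innerZl mulrA mulfV ?gt_eqF// mul1r inner_suml mulr_sumr.
  rewrite -big_split; apply: eq_bigr => i _ /=.
  rewrite innerZl /e2 innerZl mulrDr; congr (_ + _).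
  by rewrite mulrCA [gam * _]mulrA mulfV ?gt_eqF// mul1r.
suff : sqdist x' (fun=> xb) v' vb + 2 * T +
    (1 - (gam * beta) ^+ 2) * sqdist x (fun=> p) v q
    <= sqdist x (fun=> xb) v vb by move=> ?; lra.
rewrite /sqdist /T !mulr_sumr -!big_split /=; apply: ler_sum => i _.
rewrite mulrCA [X in _ + X]mulrCA -!mulrDr ler_wpM2l ?(ltW (omega_gt0 i))//.
rewrite (three_point_identity (x i) (x' i) p).
rewrite (three_point_identity (v i) (v' i) (q i)).
have gb0 : 0 <= gam * beta by rewrite mulr_ge0// ltW.
have hx : `|x' i - p| ^+ 2 <= (gam * beta) ^+ 2 * `|v i - q i| ^+ 2.
  by rewrite -exprMn ler_sqr ?nnegrE ?(mulr_ge0 gb0)// correct_x_dist.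
have hv : `|v' i - q i| ^+ 2 <= (gam * beta) ^+ 2 * `|x i - p| ^+ 2.
  by rewrite -exprMn ler_sqr ?nnegrE ?(mulr_ge0 gb0)// correct_v_dist.
by move: hx hv; move: (gam * beta) => t *; lra.
Qed.

End Step.

(** The iterates follow the exact step up to a summable error [eta]; the points
    [(p n, q^~ n)] and the corrections [x' n], [v' n] are those of the exact
    step started from the actual iterate. *)
Section InexactIteration.
Variables (beta eps : R) (gamma eta : nat -> R).
Variables (x : 'I_m -> nat -> H) (v : forall i, nat -> G i).
Variables (p : nat -> H) (q : forall i, nat -> G i).
Hypothesis beta_ge0 : 0 <= beta.
Hypothesis L_beta : forall i, opnorm (L i) <= beta.
Hypothesis eps_gt0 : 0 < eps.
Hypothesis gamma_ge : forall n, eps <= gamma n.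
Hypothesis gamma_le : forall n, gamma n * beta <= 1 - eps.
Hypothesis eta_ge0 : forall n, 0 <= eta n.
Hypothesis eta_sums : bounded_sums eta.
Hypothesis p_def : forall n, p n =
  \sum_(i < m) omega i *: (x i n - gamma n *: adjoint (L i) (v i n))
    + gamma n *: z.
Hypothesis q_sub : forall i n, subdifferential (conjugate (g i)) (q i n)
  ((gamma n)^-1 *: (v i n + gamma n *: L i (x i n) - gamma n *: r i - q i n)).
Let x' n := correct_x (gamma n) (v^~ n) (q^~ n) (p n).
Let v' n := correct_v (gamma n) (x^~ n) (p n) (q^~ n).
Hypothesis x_next : forall i n, `|x i n.+1 - x' n i| <= eta n.
Hypothesis v_next : forall i n, `|v i n.+1 - v' n i| <= eta n.

Let gamma_gt0 n : 0 < gamma n.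
Proof. exact: lt_le_trans (gamma_ge n). Qed.

Let e1 n := (gamma n)^-1 *: \sum_(i < m) omega i *: (x i n - x' n i).
Let e2 i n := (gamma n)^-1 *: (v i n - v' n i).
Let residual n := sqdist (x^~ n) (fun=> p n) (v^~ n) (q^~ n).

Let pert n : perturbed_kkt (e1 n) (e2^~ n) (p n) (q^~ n).
Proof.
exact: (step_perturbed_kkt (gamma_gt0 n) (p_def n) (q_sub^~ n)).
Qed.

(** By [fejer_step] and [sqdist_perturb], one plus the squared distance to any
    solution is a quasi-Fejer sequence with decrement [eps * residual n]. *)
Lemma inexact_fejer xb vb : kkt xb vb ->
  cvg ((fun n => sqdist (x^~ n) (fun=> xb) (v^~ n) vb) @ \oo) /\
  residual @ \oo --> (0 : R).
Proof.
move=> k; pose N n := sqdist (x^~ n) (fun=> xb) (v^~ n) vb.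
have [C etaC] := bounded_sums_ub eta_ge0 eta_sums.
have C0 : 0 <= C := le_trans (eta_ge0 0) (etaC 0%N).
have res0 n : 0 <= residual n by exact: sqdist_ge0.
have N0 n : 0 <= N n by exact: sqdist_ge0.
have [] := @quasi_fejer R (fun n => 1 + N n) (fun n => eps * residual n)
    (fun n => (2 + 2 * C) * eta n).
- by move=> n; rewrite addr_ge0.
- by move=> n; rewrite mulr_ge0// ltW.
- by move=> n; rewrite mulr_ge0// addr_ge0// mulr_ge0.
- by apply: bounded_sumsZ => //; rewrite addr_ge0// mulr_ge0.
- move=> n.
  have hp := sqdist_perturb (fun=> xb) vb (eta_ge0 n)
    (x_next^~ n) (v_next^~ n).
  apply: le_trans hp _.
  have hf := fejer_step (gamma_gt0 n)
    beta_ge0 L_beta (p_def n) (q_sub^~ n) k.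
  have heps : eps * residual n <= (1 - (gamma n * beta) ^+ 2) * residual n.
    rewrite ler_wpM2r//; have gb0 : 0 <= gamma n * beta.
      by rewrite mulr_ge0// ltW.
    have := gamma_le n; move: (gamma n * beta) gb0 => t t0 t1.
    have t_le1 : t <= 1 by move: eps_gt0 => ?; lra.
    by have := ler_piMr t0 t_le1; rewrite -expr2 => *; lra.
  have hS : 1 + sqdist (x' n) (fun=> xb) (v' n) vb
      <= 1 + N n - eps * residual n.
    by move: hf; rewrite -/(N n) -/(residual n) -/(x' n) -/(v' n) => hf; lra.
  apply: ler_pM => //.
  + by rewrite !addr_ge0 ?mulr_ge0 ?sqr_ge0.
  + by rewrite addr_ge0// sqdist_ge0.
  + by have := ler_wpM2r (eta_ge0 n) (etaC n); rewrite -expr2 => *; lra.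
- move=> h1 h2; split.
    change (cvg (N @ \oo)).
    have -> : N = (fun n => (1 + N n) - 1).
      by apply/funext => n; rewrite addrAC subrr add0r.
    by apply: is_cvgB => //; exact: is_cvg_cst.
  have -> : residual = (fun n => eps^-1 * (eps * residual n)).
    by apply/funext => n; rewrite mulKf// gt_eqF.
  by rewrite -(mulr0 eps^-1); apply: cvgM => //; exact: cvg_cst.
Qed.

Hypothesis kkt_ex : exists x0 v0, kkt x0 v0.

Let residual0 : residual @ \oo --> (0 : R).
Proof. by have [x0 [v0 k0]] := kkt_ex; exact: (inexact_fejer k0).2. Qed.

Let xp0 i : `|x i n - p n| @[n --> \oo] --> (0 : R).
Proof.
apply: (@cvg0_sqr _ _ _ _ _ (fun n => (omega i)^-1 * residual n)).
  by move=> n; exact: (sqdist_term _ _ _ _ i).1.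
by rewrite -(mulr0 (omega i)^-1); apply: cvgM => //; exact: cvg_cst.
Qed.

Let vq0 i : `|v i n - q i n| @[n --> \oo] --> (0 : R).
Proof.
apply: (@cvg0_sqr _ _ _ _ _ (fun n => (omega i)^-1 * residual n)).
  by move=> n; exact: (sqdist_term _ _ _ _ i).2.
by rewrite -(mulr0 (omega i)^-1); apply: cvgM => //; exact: cvg_cst.
Qed.

Let pq_bounded :
  exists M, (forall n, `|p n| <= M) /\ (forall i n, `|q i n| <= M).
Proof.
have [x0 [v0 k0]] := kkt_ex.
have [B hB] := cvg_norm_bounded (inexact_fejer k0).1.
have hB' n : sqdist (x^~ n) (fun=> x0) (v^~ n) v0 <= B.
  exact: le_trans (ler_norm _) (hB n).
have bnd (W : normedModType R) (w w' : nat -> W) (w0 : W) (C : R) :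
    (forall n, `|w n - w0| ^+ 2 <= C) ->
    `|w n - w' n| @[n --> \oo] --> (0 : R) ->
    exists M, forall n, `|w' n| <= M.
  move=> wC ww'; have : cvg ((fun n => `|w n - w' n|) @ \oo).
    by apply/cvg_ex; exists 0.
  move=> /cvg_norm_bounded[D hD]; exists (`|w0| + (1 + C) + D) => n.
  have -> : w' n = w0 + (w n - w0) - (w n - w' n).
    by rewrite [w0 + _]addrC subrK subKr.
  apply: le_trans (ler_normB _ _) _; apply: lerD; last first.
    by have := hD n; rewrite normr_id.
  apply: le_trans (ler_normD _ _) _; rewrite lerD2l.
  have := wC n; have := sqr_ge0 (`|w n - w0| - 1); rewrite sqrrB.
  by have := normr_ge0 (w n - w0); move: (`|w n - w0|) => t *; lra.
have sqB i n : `|x i n - x0| ^+ 2 <= (omega i)^-1 * B /\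
    `|v i n - v0 i| ^+ 2 <= (omega i)^-1 * B.
  have [h1 h2] := sqdist_term (x^~ n) (fun=> x0) (v^~ n) v0 i.
  split; [apply: le_trans h1 _|apply: le_trans h2 _];
    by rewrite ler_wpM2l// invr_ge0 ltW.
have pB (i : 'I_m) : exists M, forall n, `|p n| <= M.
  exact: (bnd H (x i) p x0 _ (fun n => (sqB i n).1) (xp0 i)).
have /choice[Mq hMq] : forall i, exists M, forall n, `|q i n| <= M.
  move=> i.
  exact: (bnd (G i) (v i) (q i) (v0 i) _ (fun n => (sqB i n).2) (vq0 i)).
have [Mp hMp] : exists M, forall n, `|p n| <= M.
  case: (pickP 'I_m) => [i _|m0]; first exact: (pB i).
  have := omega_sum1; rewrite big1 => [/eqP|i]; last by have := m0 i.
  by rewrite eq_sym oner_eq0.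
exists (`|Mp| + \sum_(i < m) `|Mq i|); split=> [n|i n].
  apply: le_trans (hMp n) _; apply: le_trans (ler_norm _) _.
  by rewrite lerDl sumr_ge0.
apply: le_trans (hMq i n) _; apply: le_trans (ler_norm _) _.
rewrite (bigD1 i)//= addrCA lerDl addr_ge0// sumr_ge0//.
Qed.

Let gamma_beta_le1 n : gamma n * beta <= 1.
Proof. by apply: le_trans (gamma_le n) _; rewrite gerBl ltW. Qed.

Let gammaV_le n : (gamma n)^-1 <= eps^-1.
Proof. by rewrite lef_pV2 ?posrE. Qed.

Let x_step i n : `|x i n - x' n i| <= `|x i n - p n| + `|v i n - q i n|.
Proof.
rewrite (le_trans (ler_distD (p n) _ _))// lerD2l distrC.
apply: le_trans (correct_x_dist _ _ _ (gamma_gt0 n) L_beta _) _.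
by rewrite ler_piMl.
Qed.

Let v_step i n : `|v i n - v' n i| <= `|x i n - p n| + `|v i n - q i n|.
Proof.
rewrite (le_trans (ler_distD (q i n) _ _))// addrC lerD2r distrC.
apply: le_trans (correct_v_dist _ _ _ (gamma_gt0 n) L_beta _) _.
by rewrite ler_piMl.
Qed.

Let e20 i : `|e2 i n| @[n --> \oo] --> (0 : R).
Proof.
apply: (@squeeze_cvgr _ _ _ _ (fun=> 0)
  (fun n => eps^-1 * (`|x i n - p n| + `|v i n - q i n|))).
- apply: nearW => n; rewrite normr_ge0 /= /e2 normrZ gtr0_norm ?invr_gt0//.
  by rewrite ler_pM ?invr_ge0 ?(ltW (gamma_gt0 n)) ?gammaV_le ?v_step.
- exact: cvg_cst.
- rewrite -(mulr0 eps^-1) -[X in _ * X]addr0.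
  by apply: cvgM; [exact: cvg_cst|exact: cvgD].
Qed.

Let e10 : `|e1 n| @[n --> \oo] --> (0 : R).
Proof.
apply: (@squeeze_cvgr _ _ _ _ (fun=> 0) (fun n => eps^-1 *
  \sum_(i < m) omega i * (`|x i n - p n| + `|v i n - q i n|))).
- apply: nearW => n; rewrite normr_ge0 /= /e1 normrZ gtr0_norm ?invr_gt0//.
  rewrite ler_pM ?invr_ge0 ?(ltW (gamma_gt0 n)) ?gammaV_le//.
  apply: le_trans (ler_norm_sum _ _ _) _; apply: ler_sum => i _.
  by rewrite normrZ gtr0_norm// ler_pM2l// x_step.
- exact: cvg_cst.
- have lim0 : eps^-1 * \sum_(i < m) omega i * (0 + 0) = 0.
    by rewrite big1 ?mulr0// => i _; rewrite addr0 mulr0.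
  suff : (fun n => eps^-1 *
      \sum_(i < m) omega i * (`|x i n - p n| + `|v i n - q i n|)) @ \oo -->
      eps^-1 * \sum_(i < m) omega i * (0 + 0) by rewrite lim0.
  apply: cvgM; first exact: cvg_cst.
  apply: cvg_sumr => i; apply: cvgM; first exact: cvg_cst.
  exact: cvgD.
Qed.

(** Weak compactness along an ultrafilter, so that no subsequence has to be
    extracted. *)
Let ultra_limit (F : set_system nat) : UltraFilter F -> \oo `<=` F ->
  exists xF vF, [/\ kkt xF vF, forall i, weak_lim F (x i) xF
    & forall i, weak_lim F (v i) (vF i)].
Proof.
move=> FU oF; have PF := @ultra_proper _ F FU.
have [M [pM qM]] := pq_bounded.
have [x0 [v0 [gx0 _]]] := kkt_ex.
have [xF pF] := ultra_weak_lim FU pM.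
have [vF qF] : exists vF : forall i, G i, forall i, weak_lim F (q i) (vF i).
  have h i : {l : G i | weak_lim F (q i) l}.
    by apply: cid; exact: ultra_weak_lim FU (qM i).
  by exists (fun i => sval (h i)) => i; exact: svalP.
exists xF, vF; split.
- apply: (perturbed_kkt_limit (FF := PF) _ pert pM qM) => //.
  + by move=> i; exists (L i x0 - r i), (v0 i); exact: gx0.
  + exact: cvg_along oF e10.
  + by move=> i; exact: cvg_along oF (e20 i).
- move=> i; have -> : x i = (fun n => p n + (x i n - p n)).
    by apply/funext => n; rewrite addrCA subrr addr0.
  by apply: weak_lim_strong => //; exact: cvg_along oF (xp0 i).
- move=> i; have -> : v i = (fun n => q i n + (v i n - q i n)).
    by apply/funext => n; rewrite addrCA subrr addr0.
  by apply: weak_lim_strong => //; exact: cvg_along oF (vq0 i).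
Qed.

(** Opial's argument: the difference of the squared distances to two solutions
    converges, and it is affine in the iterate, so its limit can be read off
    along either ultrafilter. *)
Let ultra_limit_unique (F1 F2 : set_system nat) x1 x2 v1 v2 :
  ProperFilter F1 -> \oo `<=` F1 -> ProperFilter F2 -> \oo `<=` F2 ->
  kkt x1 v1 -> kkt x2 v2 ->
  (forall i, weak_lim F1 (x i) x1) -> (forall i, weak_lim F1 (v i) (v1 i)) ->
  (forall i, weak_lim F2 (x i) x2) -> (forall i, weak_lim F2 (v i) (v2 i)) ->
  x1 = x2 /\ forall i, v1 i = v2 i.
Proof.
move=> PF1 oF1 PF2 oF2 k1 k2 x1F v1F x2F v2F.
pose c i := `|x1| ^+ 2 - `|x2| ^+ 2 + (`|v1 i| ^+ 2 - `|v2 i| ^+ 2).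
pose K n := sqdist (x^~ n) (fun=> x1) (v^~ n) v1
          - sqdist (x^~ n) (fun=> x2) (v^~ n) v2.
have KE : K = (fun n => \sum_(i < m) omega i *
    (c i - 2 * (inner (x i n) (x1 - x2) + inner (v i n) (v1 i - v2 i)))).
  apply/funext => n; rewrite /K /sqdist -sumrB; apply: eq_bigr => i _.
  by rewrite -mulrBr !normB_sqr /c !innerBr; congr (_ * _); ring.
have Kcvg : cvg (K @ \oo).
  by apply: is_cvgB; [exact: (inexact_fejer k1).1|exact: (inexact_fejer k2).1].
have KF (F : set_system nat) xF vF : ProperFilter F -> \oo `<=` F ->
    (forall i, weak_lim F (x i) xF) -> (forall i, weak_lim F (v i) (vF i)) ->
    lim (K @ \oo) = \sum_(i < m) omega i *
      (c i - 2 * (inner xF (x1 - x2) + inner (vF i) (v1 i - v2 i))).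
  move=> PF oF xFl vFl.
  apply: (cvg_unique (@Rhausdorff R) (cvg_along oF Kcvg)).
  rewrite KE; apply: cvg_sumr => i; apply: cvgM; first exact: cvg_cst.
  apply: cvgB; first exact: cvg_cst.
  apply: cvgM; first exact: cvg_cst.
  by apply: cvgD; [exact: xFl|exact: vFl].
have : sqdist (fun=> x1) (fun=> x2) v1 v2 = 0.
  have := KF _ _ _ PF1 oF1 x1F v1F; rewrite (KF _ _ _ PF2 oF2 x2F v2F).
  move=> /eqP; rewrite -subr_eq0 -sumrB => /eqP h.
  have /eqP : 2 * sqdist (fun=> x1) (fun=> x2) v1 v2 = 0.
    apply: etrans h; rewrite mulr_sumr; apply: eq_bigr => i _.
    by rewrite -!inner_norm !innerBl; ring.
  by rewrite mulf_eq0 pnatr_eq0 /= => /eqP.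
have sq0 (W : normedModType R) (w w' : W) (t : R) :
    `|w - w'| ^+ 2 <= t * 0 -> w = w'.
  rewrite mulr0 => h; apply/eqP; rewrite -subr_eq0 -normr_eq0 -sqrf_eq0.
  by rewrite eq_le h sqr_ge0.
move=> d0; split=> [|i].
  case: (pickP 'I_m) => [i _|m0].
    have [+ _] := sqdist_term (fun=> x1) (fun=> x2) v1 v2 i.
    by rewrite d0; exact: sq0.
  have := omega_sum1; rewrite big1 => [/eqP|i]; last by have := m0 i.
  by rewrite eq_sym oner_eq0.
have [_] := sqdist_term (fun=> x1) (fun=> x2) v1 v2 i.
by rewrite d0; exact: sq0.
Qed.

Lemma inexact_cvg : exists xb vb, [/\ kkt xb vb,
  forall i, weak_cvg (x i) xb, forall i, weak_cvg (v i) (vb i)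
  & (forall i, strongly_convex_at (conjugate (g i)) (vb i)) ->
    forall i, v i @ \oo --> vb i].
Proof.
have [F0 [FU0 oF0]] := ultraFilterLemma eventually_filter.
have [xb [vb [kb xb0 vb0]]] := ultra_limit FU0 oF0.
exists xb, vb; split=> //.
- move=> i y; apply: cvg_ultra => F FU oF.
  have [xF [vF [kF xFl vFl]]] := ultra_limit FU oF.
  have [-> _] := ultra_limit_unique ultra_proper oF0 ultra_proper oF kb kF
    xb0 vb0 xFl vFl.
  exact: xFl.
- move=> i y; apply: cvg_ultra => F FU oF.
  have [xF [vF [kF xFl vFl]]] := ultra_limit FU oF.
  have [_ ->] := ultra_limit_unique ultra_proper oF0 ultra_proper oF kb kF
    xb0 vb0 xFl vFl.
  exact: vFl.
move=> vsc i; have [M [pM qM]] := pq_bounded.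
have qv := perturbed_kkt_strong_limit pert pM qM
  e10 e20 kb vsc.
rewrite (_ : v i = fun n => vb i + ((v i n - q i n) + (q i n - vb i))).
  rewrite -[X in _ --> X]addr0 -[X in _ --> _ + X]addr0.
  apply: cvgD; first exact: cvg_cst.
  by apply: cvgD; apply: norm_cvg0; [exact: vq0|exact: qv].
by apply/funext => n; rewrite subrKA addrCA subrr addr0.
Qed.

End InexactIteration.

End CompositeProblem.

Theorem proposition4p4 (R : realType) (H : hilbertType R) (m : nat)
  (m_ge1 : (1 <= m)%N) (z : H) (omega : 'I_m -> R)
  (omega01 : forall i, 0 < omega i <= 1)
  (omega_sum1 : \sum_(i < m) omega i = 1)
  (G : 'I_m -> hilbertType R) (r : forall i, G i)
  (g : forall i, G i -> \bar R) (g_Gamma0 : forall i, Gamma0 (g i))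
  (L : forall i, {linear H -> G i})
  (L_bounded : forall i, bounded_fun_norm (L i))
  (L_nonzero : forall i, exists x : H, L i x != 0)
  (z_ran : ran (composite_operator omega r g L) z)
  (a1 c1 : 'I_m -> nat -> H) (a2 b c2 : forall i : 'I_m, nat -> G i)
  (a1_summable : forall i, abs_summable (a1 i))
  (c1_summable : forall i, abs_summable (c1 i))
  (a2_summable : forall i, abs_summable (a2 i))
  (b_summable : forall i, abs_summable (b i))
  (c2_summable : forall i, abs_summable (c2 i))
  (beta : R) (beta_def : beta = \big[Num.max/0]_(i < m) opnorm (L i))
  (eps : R) (eps_range : 0 < eps < 1 / (beta + 1))
  (gamma : nat -> R)
  (gamma_range : forall n, eps <= gamma n <= (1 - eps) / beta)
  (xs : 'I_m -> nat -> H) (v : forall i : 'I_m, nat -> G i)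
  (x : nat -> H)
  (y1 : 'I_m -> nat -> H) (y2 : forall i : 'I_m, nat -> G i)
  (p1 : nat -> H) (p2 : forall i : 'I_m, nat -> G i)
  (q1 : 'I_m -> nat -> H) (q2 : forall i : 'I_m, nat -> G i)
  (x_def : forall n, x n = \sum_(i < m) omega i *: xs i n)
  (y1_def : forall i n,
    y1 i n = xs i n - gamma n *: (adjoint (L i) (v i n) + a1 i n))
  (y2_def : forall i n,
    y2 i n = v i n + gamma n *: (L i (xs i n) + a2 i n))
  (p1_def : forall n,
    p1 n = \sum_(i < m) omega i *: y1 i n + gamma n *: z)
  (p2_def : forall i n,
    p2 i n = prox (fun u : G i => ((gamma n)%:E * conjugate (g i) u)%E)
                  (y2 i n - gamma n *: r i) + b i n)
  (q1_def : forall i n,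
    q1 i n = p1 n - gamma n *: (adjoint (L i) (p2 i n) + c1 i n))
  (q2_def : forall i n,
    q2 i n = p2 i n + gamma n *: (L i (p1 n) + c2 i n))
  (xs_rec : forall i n, xs i n.+1 = xs i n - y1 i n + q1 i n)
  (v_rec : forall i n, v i n.+1 = v i n - y2 i n + q2 i n) :
  exists (xbar : H) (vbar : forall i, G i),
    [/\ primal_solution z omega r g L xbar,
        dual_solution z omega r g L vbar,
        forall i, subdifferential (g i) (L i xbar - r i) (vbar i),
        weak_cvg x xbar /\ (forall i, weak_cvg (v i) (vbar i))
      & (forall i, strongly_convex_at (conjugate (g i)) (vbar i)) ->
        forall i, v i @ \oo --> vbar i].
Proof.
have omega_gt0 i : 0 < omega i by case/andP: (omega01 i).
have L_beta i : opnorm (L i) <= beta.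
  by rewrite beta_def; exact: le_bigmax.
have beta_gt0 : 0 < beta.
  have i := Ordinal m_ge1; apply: lt_le_trans (L_beta i).
  have [w w0] := L_nonzero i.
  have nw : 0 < `|L i w| by rewrite normr_gt0.
  have := lt_le_trans nw (opnormP (L_bounded i) w).
  rewrite lt_neqAle mulr_ge0 ?opnorm_ge0// andbT eq_sym mulf_eq0 negb_or.
  by move=> /andP[? _]; rewrite lt_neqAle eq_sym opnorm_ge0 ?andbT.
have beta_ge0 := ltW beta_gt0.
have eps_gt0 : 0 < eps by case/andP: eps_range.
have gamma_ge n : eps <= gamma n by case/andP: (gamma_range n).
have gamma_gt0 n : 0 < gamma n := lt_le_trans eps_gt0 (gamma_ge n).
pose Gam := (1 - eps) / beta.
have gamma_Gam n : gamma n <= Gam by case/andP: (gamma_range n).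
have Gam_ge0 : 0 <= Gam.
  exact: le_trans (ltW (gamma_gt0 0%N)) (gamma_Gam 0%N).
have gamma_le n : gamma n * beta <= 1 - eps by rewrite -ler_pdivlMr.
have gamma_beta n : gamma n * beta <= 1.
  by apply: le_trans (gamma_le n) _; rewrite gerBl ltW.
have [x0 [v0 k0]] : exists x0 v0, kkt z omega r g L x0 v0.
  have [x0 [a hfa az]] := z_ran.
  have h i : {w : G i | subdifferential (g i) (L i x0 - r i) w /\
      omega i *: adjoint (L i) w = a i}.
    by apply: cid; have [w gw wa] := hfa i; exists w.
  exists x0, (fun i => sval (h i)); split=> [i|]; first exact: (svalP (h i)).1.
  by rewrite -az; apply: eq_bigr => i _; exact: (svalP (h i)).2.
(* the forward-backward point computed without errors from the iterate *)
pose P n := \sum_(i < m) omega i *: (xs i n - gamma n *: adjoint (L i) (v i n))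
  + gamma n *: z.
pose prx i n := prox (fun u : G i => ((gamma n)%:E * conjugate (g i) u)%E).
pose Q i n := prx i n (v i n + gamma n *: L i (xs i n) - gamma n *: r i).
have Q_sub i n : subdifferential (conjugate (g i)) (Q i n)
    ((gamma n)^-1 *:
       (v i n + gamma n *: L i (xs i n) - gamma n *: r i - Q i n)).
  exact: (prox_conjugate_subdifferential _ (g_Gamma0 i) (k0.1 i)).
pose err i n := `|a1 i n| + `|a2 i n| + `|b i n| + `|c1 i n| + `|c2 i n|.
pose S n := \sum_(i < m) err i n.
have err_ge0 i n : 0 <= err i n by rewrite !addr_ge0.
have err_S i n : err i n <= S n.
  by rewrite /S (bigD1 i)//= lerDl sumr_ge0.
have S_ge0 n : 0 <= S n by exact: sumr_ge0.
have S_sums : bounded_sums S.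
  apply: bounded_sums_sum => i.
  by do ![apply: bounded_sumsD]; exact: abs_summable_bounded_sums.
have p1P n : `|p1 n - P n| <= Gam * S n.
  have -> : p1 n - P n = - (gamma n *: \sum_(i < m) omega i *: a1 i n).
    rewrite p1_def /P opprD addrACA subrr addr0 -sumrB scaler_sumr -sumrN.
    apply: eq_bigr => i _; rewrite y1_def.
    by apply: inner_inj => w; rewrite !innerE; ring.
  rewrite normrN normrZ gtr0_norm// ler_pM ?(ltW (gamma_gt0 n))//.
  apply: le_trans (ler_norm_sum _ _ _) _; apply: ler_sum => i _.
  rewrite normrZ gtr0_norm// /err -!addrA.
  apply: (@le_trans _ _ `|a1 i n|); last by rewrite lerDl !addr_ge0.
  by rewrite ler_piMl//; case/andP: (omega01 i).
have p2Q i n : `|p2 i n - Q i n| <= Gam * `|a2 i n| + `|b i n|.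
  rewrite p2_def addrAC; apply: le_trans (ler_normD _ _) _; rewrite lerD2r.
  apply: le_trans
    (prox_conjugate_nonexpansive _ _ (g_Gamma0 i) (k0.1 i) (gamma_gt0 n)) _.
  have -> : y2 i n - gamma n *: r i -
      (v i n + gamma n *: L i (xs i n) - gamma n *: r i) = gamma n *: a2 i n.
    by rewrite opprB addrA subrK y2_def scalerDr addrA addrAC subrr add0r.
  by rewrite normrZ gtr0_norm// ler_wpM2r.
(* 3 * Gam + 1 collects the coefficients in the two estimates below *)
pose eta n := (3 * Gam + 1) * S n.
have eta_ge0 n : 0 <= eta n by rewrite mulr_ge0// addr_ge0// mulr_ge0.
have eta_sums : bounded_sums eta.
  by apply: bounded_sumsZ => //; rewrite addr_ge0// mulr_ge0.
have Gerr i n : Gam * err i n <= Gam * S n by rewrite ler_wpM2l.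
have Gge0 (W : normedModType R) (w : W) : 0 <= Gam * `|w| by rewrite mulr_ge0.
have x_next i n :
    `|xs i n.+1 - correct_x L (gamma n) (v^~ n) (Q^~ n) (P n) i| <= eta n.
  have -> : xs i n.+1 - correct_x L (gamma n) (v^~ n) (Q^~ n) (P n) i =
      gamma n *: a1 i n - gamma n *: c1 i n + (p1 n - P n)
      - gamma n *: (adjoint (L i) (p2 i n - Q i n)).
    rewrite adjointB// xs_rec y1_def q1_def /correct_x.
    by apply: inner_inj => w; rewrite !innerE; ring.
  apply: le_trans (ler_normB _ _) _.
  apply: (@le_trans _ _ ((Gam * `|a1 i n| + Gam * `|c1 i n| + Gam * S n)
     + (Gam * `|a2 i n| + `|b i n|))).
    apply: lerD.
      apply: le_trans (ler_normD _ _) _; apply: lerD => //.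
      apply: le_trans (ler_normB _ _) _.
      by rewrite !normrZ gtr0_norm// lerD ?ler_wpM2r.
    apply: le_trans (p2Q i n); rewrite normrZ gtr0_norm//.
    have g0 := ltW (gamma_gt0 n).
    apply: le_trans (ler_wpM2l g0 (adjoint_bound (L_bounded i) _)) _.
    rewrite mulrA ler_piMl//; apply: le_trans (gamma_beta n).
    by rewrite ler_wpM2l// ltW.
  have := Gerr i n; have := err_S i n; rewrite /eta /err.
  have := Gge0 _ (c2 i n); have := Gge0 _ (b i n).
  have := normr_ge0 (a1 i n); have := normr_ge0 (a2 i n).
  have := normr_ge0 (c1 i n); have := normr_ge0 (c2 i n).
  have := mulr_ge0 Gam_ge0 (S_ge0 n).
  move: (`|a1 i n|) (`|a2 i n|) (`|b i n|) (`|c1 i n|) (`|c2 i n|) (S n) (Gam).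
  by move=> A A2 B C C2 s Ga *; lra.
have v_next i n :
    `|v i n.+1 - correct_v L (gamma n) (xs^~ n) (P n) (Q^~ n) i| <= eta n.
  have -> : v i n.+1 - correct_v L (gamma n) (xs^~ n) (P n) (Q^~ n) i =
      gamma n *: c2 i n - gamma n *: a2 i n + (p2 i n - Q i n)
      + gamma n *: (L i (p1 n - P n)).
    rewrite (linearB (L i)) v_rec y2_def q2_def /correct_v.
    by apply: inner_inj => w; rewrite !innerE; ring.
  apply: le_trans (ler_normD _ _) _.
  apply: (@le_trans _ _ ((Gam * `|c2 i n| + Gam * `|a2 i n| +
     (Gam * `|a2 i n| + `|b i n|)) + Gam * S n)).
    apply: lerD.
      apply: le_trans (ler_normD _ _) _; apply: lerD => //.
      apply: le_trans (ler_normB _ _) _.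
      by rewrite !normrZ gtr0_norm// lerD ?ler_wpM2r.
    apply: le_trans (p1P n); rewrite normrZ gtr0_norm//.
    apply: le_trans (ler_wpM2l (ltW (gamma_gt0 n)) (opnormP (L_bounded i) _)) _.
    rewrite mulrA ler_piMl//; apply: le_trans (gamma_beta n).
    by rewrite ler_wpM2l// ltW.
  have := Gerr i n; have := err_S i n; rewrite /eta /err.
  have := Gge0 _ (c1 i n); have := Gge0 _ (b i n); have := Gge0 _ (a1 i n).
  have := Gge0 _ (c2 i n).
  have := normr_ge0 (a1 i n); have := normr_ge0 (a2 i n).
  have := normr_ge0 (c1 i n); have := normr_ge0 (c2 i n).
  have := mulr_ge0 Gam_ge0 (S_ge0 n).
  move: (`|a1 i n|) (`|a2 i n|) (`|b i n|) (`|c1 i n|) (`|c2 i n|) (S n) (Gam).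
  by move=> A A2 B C C2 s Ga *; lra.
have [xb [vb [kb xsb vsb vstrong]]] := inexact_cvg omega_gt0 omega_sum1
  g_Gamma0 L_bounded beta_ge0 L_beta eps_gt0 gamma_ge gamma_le eta_ge0
  eta_sums (fun=> erefl) Q_sub x_next v_next (ex_intro _ x0 (ex_intro _ v0 k0)).
exists xb, vb; split=> //.
- exact: kkt_primal kb.
- exact: kkt_dual kb.
- exact: kb.1.
split=> // y.
rewrite (_ : (fun n => inner (x n) y) =
    fun n => \sum_(i < m) omega i * inner (xs i n) y); last first.
  apply/funext => n; rewrite x_def inner_suml.
  by apply: eq_bigr => i _; rewrite innerZl.
rewrite -[inner xb y]mul1r -omega_sum1 mulr_suml.
by apply: cvg_sumr => i; apply: cvgM; [exact: cvg_cst|exact: xsb].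
Qed.
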